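(* Consider the category whose objects are the nd-semiring systems of hyper-type $(\mathcal A,\mathcal T,(-),\preceq)$ with $\mathcal T=\mathcal A^\times$ and whose morphisms are weak morphisms, and the category $\mathsf{wFR}$ of coherent fuzzy rings with weak fuzzy morphisms. There is a dominant functor from the former category to $\mathsf{wFR}$.
   Context: **Systems.** Let $(\mathcal A,+,0)$ be a commutative additive monoid with a subset $\mathcal T\subset\mathcal A$, $0\notin\mathcal T$, $\mathcal T_0=\mathcal T\cup\{0\}$. $\mathcal A$ is a $\mathcal T$-gen bimodule if $\mathcal T_0$ is a multiplicative monoid with unit $1\in\mathcal T$, additively generates $\mathcal A$, and acts on $\mathcal A$ on the left with $(a_1a_2)b=a_1(a_2b)$, $0b=0$, $1b=b$, $a1=a$, $a0=0$, $a\sum b_i=\sum ab_i$ ($a,a_i\in\mathcal T_0$, $b,b_i\in\mathcal A$), and likewise on the right. It is a $\mathcal T$-gen nd-semiring if moreover $(\mathcal A,\cdot,1)$ is a multiplicative monoid with $0$ absorbing whose multiplication restricts to the $\mathcal T_0$-actions (full distributivity is not required). A negation map is an additive isomorphism $(-):\mathcal A\to\mathcal A$ of order $\le2$ with $(-)1\in\mathcal T$ and $((-)a)b=(-)(ab)=a((-)b)$ for $a\in\mathcal T,b\in\mathcal A$ (similarly on the right). Write $b(-)c=b+((-)c)$, $b^\circ=b(-)b$, $\mathcal A^\circ=\{b^\circ\}$. A triple is a $\mathcal T$-gen bimodule with a negation map such that $\mathcal A^\circ\cap\mathcal T=\emptyset$. A surpassing relation $\preceq$ is a reflexive transitive relation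 with: $b\preceq0\Rightarrow b=0$; $0\preceq b^\circ$; $b_i\preceq b_i'$ ($i=1,2$) implies $a_1b_1+a_2b_2\preceq a_1b_1'+a_2b_2'$ and $b_1a_1+b_2a_2\preceq b_1'a_1+b_2'a_2$ for $a_i\in\mathcal T$, and (for nd-semirings) $b_1b_2\preceq b_1'b_2'$; $a\preceq a'$ with $a,a'\in\mathcal T_0$ implies $a=a'$. Put $\mathcal A_{\rm Null}=\{b:0\preceq b\}$. A system is a triple with a surpassing relation such that $a,a'\in\mathcal T$ and $a(-)a'\in\mathcal A_{\rm Null}$ imply $a=a'$; an nd-semiring system is one where $\mathcal A$ is a $\mathcal T$-gen nd-semiring. It is of hyper-type if whenever $b_i,b_i'\in\mathcal A$ and $\sum_ib_ib_i'\in\mathcal A_{\rm Null}$ there are $a_i,a_i'\in\mathcal T_0$ with $a_i\preceq b_i$, $a_i'\preceq b_i'$ and $\sum_ia_ia_i'\in\mathcal A_{\rm Null}$. $\mathcal A^\times$ is the set of multiplicatively invertible elements. A weak morphism from $(\mathcal A,\mathcal T,(-),\preceq)$ to $(\mathcal A',\mathcal T',(-)',\preceq')$ is a multiplicative map $f:\mathcal T\to\mathcal T'$ such that $\sum a_i\in\mathcal A_{\rm Null}$ with $a_i\in\mathcal T$ implies $\sum f(a_i)\in\mathcal A'_{\rm Null}$. **Fuzzy rings.** $(\mathcal A,+,\cdot,0,1)$ is a fuzzy ring if it is an $\mathcal A^\times$-gen bimodule (where $(\mathcal A,\cdot,1)$ is a multiplicative monoid with $0$ absorbing whose multiplication restricts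 to the left and right actions of $\mathcal A^\times\cup\{0\}$ on $\mathcal A$, full distributivity not being required) and has a distinguished element $\varepsilon$ and a proper ideal $\mathcal I$ such that, for $b_i\in\mathcal A$: (1) $\varepsilon^2=1$; (2) $a=\varepsilon$ iff $a\in\mathcal A^\times$ and $1+a\in\mathcal I$; (3) if $b_1+b_2,\ b_3+b_4\in\mathcal I$ then $b_1b_3+\varepsilon b_2b_4\in\mathcal I$; (4) if $b_1+b_2(b_3+b_4)\in\mathcal I$ then $b_1+b_2b_3+b_2b_4\in\mathcal I$. It is coherent if $\mathcal A^\times$ spans $(\mathcal A,+)$. A weak fuzzy morphism $(\mathcal A,\mathcal I)\to(\mathcal A',\mathcal I')$ is a multiplicative map $f:\mathcal A^\times\to\mathcal A'^\times$ such that $\sum a_i\in\mathcal I$ with $a_i\in\mathcal A^\times$ implies $\sum f(a_i)\in\mathcal I'$. **Dominant functor.** $C$ is a retract of $D$ if there are morphisms $i:C\to D$, $r:D\to C$ with $r\circ i=1_C$. A functor $\Psi:\mathfrak C\to\mathfrak D$ is dominant if every object of $\mathfrak D$ is a retract of $\Psi(X)$ for some object $X$ of $\mathfrak C$. *)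

(* Defs.v *)
From HB Require Import structures.
From mathcomp Require Import all_boot.
From mathcomp Require Import boolp classical_sets.

Set Implicit Arguments.
Unset Strict Implicit.
Unset Printing Implicit Defensive.

(* Products and 1 are those of monoidType (group_scope); sums and 0 are those
   of nmodType (ring_scope).  ssralg is not imported, since its ring product
   would capture [*] inside sums. *)
Local Open Scope classical_set_scope.
Local Open Scope ring_scope.
Local Open Scope group_scope.

HB.structure Definition AddMulMonoid := {A of Algebra.Nmodule A & Monoid A}.

(* Neither side of distributivity is required. *)
HB.mixin Record hasAbsorbingZero A of AddMulMonoid A := {
  absorb0l : forall b : A, 0 * b = 0 :> A;
  absorb0r : forall b : A, b * 0 = 0 :> A
}.

#[short(type="absMonoidType")]
HB.structure Definition AbsMonoid :=
  {A of AddMulMonoid A & hasAbsorbingZero A}.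

Section Elements.
Context {A : absMonoidType}.

Definition invertible : set A := [set b | exists c, b * c = 1 /\ c * b = 1].

Definition with0 (T : set A) : set A := T `|` [set 0].

Definition spans (S : set A) : Prop :=
  forall b, exists (n : nat) (a : 'I_n -> A),
    (forall i, S (a i)) /\ b = \sum_i a i.

(* T-gen nd-semirings.  The T_0-actions are the restrictions of the
   multiplication of A to T_0 * A and A * T_0, so the unit, zero and
   associativity axioms of a T-gen bimodule are those of [absMonoidType]. *)
Record gen_ndsemiring (T : set A) : Prop := {
  gen_T0 : ~ T 0;
  gen_T1 : T 1;
  gen_TM : forall a b, with0 T a -> with0 T b -> with0 T (a * b);
  gen_spans : spans (with0 T);
  gen_suml : forall a n (b : 'I_n -> A), with0 T a ->
    a * (\sum_i b i) = \sum_i a * b i;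
  gen_sumr : forall a n (b : 'I_n -> A), with0 T a ->
    (\sum_i b i) * a = \sum_i b i * a
}.

Record negation_map (T : set A) (neg : A -> A) : Prop := {
  neg_zero : neg 0 = 0;
  neg_add : forall b c, neg (b + c) = neg b + neg c;
  neg_invol : forall b, neg (neg b) = b;
  neg_one : T (neg 1);
  neg_mulTl : forall a b, T a -> neg a * b = neg (a * b);
  neg_mulTr : forall a b, T a -> a * neg b = neg (a * b);
  neg_rmulTr : forall a b, T a -> b * neg a = neg (b * a);
  neg_rmulTl : forall a b, T a -> neg b * a = neg (b * a)
}.

Definition quasi_zero (neg : A -> A) (b : A) : A := b + neg b.

Definition Null (le : A -> A -> Prop) : set A := [set b | le 0 b].

Record nd_triple (T : set A) (neg : A -> A) : Prop := {
  triple_gen : gen_ndsemiring T;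
  triple_neg : negation_map T neg;
  triple_disj : forall b, ~ T (quasi_zero neg b)
}.

Record surpassing (T : set A) (neg : A -> A) (le : A -> A -> Prop) : Prop := {
  surp_refl : forall b, le b b;
  surp_trans : forall b c d, le b c -> le c d -> le b d;
  surp_0 : forall b, le b 0 -> b = 0;
  surp_quasi : forall b, le 0 (quasi_zero neg b);
  surp_linl : forall a1 a2 b1 b2 c1 c2, T a1 -> T a2 ->
    le b1 c1 -> le b2 c2 -> le (a1 * b1 + a2 * b2) (a1 * c1 + a2 * c2);
  surp_linr : forall a1 a2 b1 b2 c1 c2, T a1 -> T a2 ->
    le b1 c1 -> le b2 c2 -> le (b1 * a1 + b2 * a2) (c1 * a1 + c2 * a2);
  surp_mul : forall b1 b2 c1 c2, le b1 c1 -> le b2 c2 -> le (b1 * b2) (c1 * c2);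
  surp_T0 : forall a a', with0 T a -> with0 T a' -> le a a' -> a = a'
}.

Record nd_system_axiom (T : set A) (neg : A -> A) (le : A -> A -> Prop)
    : Prop := {
  system_triple : nd_triple T neg;
  system_surp : surpassing T neg le;
  system_uniq_neg : forall a a', T a -> T a' -> Null le (a + neg a') -> a = a'
}.

Definition hyper_type (T : set A) (le : A -> A -> Prop) : Prop :=
  forall n (b b' : 'I_n -> A), Null le (\sum_i b i * b' i) ->
  exists a a' : 'I_n -> A,
    [/\ forall i, with0 T (a i) /\ with0 T (a' i),
        forall i, le (a i) (b i) /\ le (a' i) (b' i)
      & Null le (\sum_i a i * a' i)].

Record proper_ideal (I : set A) : Prop := {
  ideal_0 : I 0;
  ideal_D : forall b c, I b -> I c -> I (b + c);
  ideal_Ml : forall b c, I c -> I (b * c);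
  ideal_Mr : forall b c, I b -> I (b * c);
  ideal_proper : I <> setT
}.

Record fuzzy_axiom (eps : A) (I : set A) : Prop := {
  fuzzy_gen : gen_ndsemiring invertible;
  fuzzy_ideal : proper_ideal I;
  fuzzy_eps2 : eps * eps = 1;
  fuzzy_epsP : forall a : A, a = eps <-> invertible a /\ I (1 + a);
  fuzzy_mul : forall b1 b2 b3 b4 : A,
    I (b1 + b2) -> I (b3 + b4) -> I (b1 * b3 + eps * b2 * b4);
  fuzzy_distr : forall b1 b2 b3 b4 : A,
    I (b1 + b2 * (b3 + b4)) -> I (b1 + b2 * b3 + b2 * b4)
}.

End Elements.

Record nd_system := NdSystem {
  system_carrier :> absMonoidType;
  system_T : set system_carrier;
  system_neg : system_carrier -> system_carrier;
  system_le : system_carrier -> system_carrier -> Prop;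
  system_axiom : nd_system_axiom system_T system_neg system_le
}.
Arguments system_T : clear implicits.
Arguments system_neg : clear implicits.
Arguments system_le : clear implicits.

Record hyper_system := HyperSystem {
  hyper_nd_system :> nd_system;
  hyper_hyper_type :
    hyper_type (system_T hyper_nd_system) (system_le hyper_nd_system);
  hyper_invertible : system_T hyper_nd_system = invertible
}.

Record fuzzy_ring := FuzzyRing {
  fuzzy_carrier :> absMonoidType;
  fuzzy_eps : fuzzy_carrier;
  fuzzy_I : set fuzzy_carrier;
  fuzzy_ringP : fuzzy_axiom fuzzy_eps fuzzy_I
}.
Arguments fuzzy_eps : clear implicits.
Arguments fuzzy_I : clear implicits.

Record coherent_fuzzy_ring := CoherentFuzzyRing {
  coherent_fuzzy :> fuzzy_ring;
  coherent_spans : spans (@invertible coherent_fuzzy)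
}.

(* N is the null part: Null le for a system, the ideal I for a fuzzy ring.
   The product condition is relational because T need not be closed under
   products in general. *)
Record weak_hom (A A' : absMonoidType) (T N : set A) (T' N' : set A') :=
  WeakHom {
  weak_fun :> T -> T';
  weak_mul : forall a b c : T, val c = val a * val b ->
    val (weak_fun c) = val (weak_fun a) * val (weak_fun b);
  weak_null : forall n (a : 'I_n -> T),
    N (\sum_i val (a i)) -> N' (\sum_i val (weak_fun (a i)))
}.

Lemma weak_hom_eq (A A' : absMonoidType) (T N : set A) (T' N' : set A')
  (f g : weak_hom T N T' N') : f =1 g -> f = g.
Proof.
case: f g => [f fM fN] [g gM gN] /= /funext fg; subst g.
by rewrite (Prop_irrelevance fM gM) (Prop_irrelevance fN gN).
Qed.

Definition weak_id (A : absMonoidType) (T N : set A) : weak_hom T N T N :=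
  @WeakHom A A T N T N id (fun _ _ _ e => e) (fun _ _ h => h).

Definition weak_comp (A1 A2 A3 : absMonoidType) (T1 N1 : set A1)
    (T2 N2 : set A2) (T3 N3 : set A3)
    (g : weak_hom T2 N2 T3 N3) (f : weak_hom T1 N1 T2 N2) :
    weak_hom T1 N1 T3 N3 :=
  @WeakHom _ _ T1 N1 T3 N3 (g \o f)
    (fun _ _ _ e => weak_mul g (weak_mul f e))
    (fun _ _ h => weak_null g (weak_null f h)).

Record category := Category {
  obj :> Type;
  hom : obj -> obj -> Type;
  idm : forall X, hom X X;
  comp : forall X Y Z, hom Y Z -> hom X Y -> hom X Z;
  comp1m : forall X Y (f : hom X Y), comp (idm Y) f = f;
  compm1 : forall X Y (f : hom X Y), comp f (idm X) = f;
  compA : forall W X Y Z (h : hom Y Z) (g : hom X Y) (f : hom W X),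
    comp h (comp g f) = comp (comp h g) f
}.

Record functor (C D : category) := Functor {
  fobj :> C -> D;
  fmap : forall X Y : C, hom X Y -> hom (fobj X) (fobj Y);
  fmap_id : forall X : C, fmap (idm X) = idm (fobj X);
  fmap_comp : forall (X Y Z : C) (g : hom Y Z) (f : hom X Y),
    fmap (comp g f) = comp (fmap g) (fmap f)
}.

Definition retract (C : category) (X Y : C) : Prop :=
  exists (i : hom X Y) (r : hom Y X), comp r i = idm X.

Definition dominant (C D : category) (Psi : functor C D) : Prop :=
  forall Y : D, exists X : C, retract Y (Psi X).

Definition hyper_systems : category.
Proof.
refine (@Category hyper_system
  (fun X Y => weak_hom (system_T X) (Null (system_le X))
                       (system_T Y) (Null (system_le Y)))
  (fun X => weak_id _ _) (fun X Y Z g f => weak_comp g f) _ _ _).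
- by move=> X Y f; apply: weak_hom_eq.
- by move=> X Y f; apply: weak_hom_eq.
- by move=> W X Y Z h g f; apply: weak_hom_eq.
Defined.

Definition wFR : category.
Proof.
refine (@Category coherent_fuzzy_ring
  (fun X Y => weak_hom (@invertible X) (fuzzy_I X)
                       (@invertible Y) (fuzzy_I Y))
  (fun X => weak_id _ _) (fun X Y Z g f => weak_comp g f) _ _ _).
- by move=> X Y f; apply: weak_hom_eq.
- by move=> X Y f; apply: weak_hom_eq.
- by move=> W X Y Z h g f; apply: weak_hom_eq.
Defined.

(* Main.v *)
From HB Require Import structures.
From Stdlib Require Import ZArith Lia.
From mathcomp Require Import all_boot.
From mathcomp Require Import boolp classical_sets.
Require Import Defs.

Set Implicit Arguments.
Unset Strict Implicit.
Unset Printing Implicit Defensive.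

Local Open Scope quotient_scope.
Local Open Scope ring_scope.
Local Open Scope group_scope.

(** A weak morphism of hyper-type systems restricts to a group morphism between
the groups of units, and it maps (-)1 to (-)1.  Conversely, every group H with a
central element e of square 1, e <> 1, is the group of units of a hyper-type
system with (-)1 = e: in [coarse_field] a sum of units is null unless it is a
single unit or a sum of two units x, y with y <> e x, so that the additive
structure carries no information beyond e.  It is therefore enough to find a
functor from groups with a distinguished element to fuzzy rings such that every
coherent fuzzy ring is a retract of one of its values on a pair (H, e).

The assignment that keeps the units and takes the null elements for the ideal
is a functor, but it is not dominant.  In a hyper-type system a null sum
b + c = 0 of sums of units always has a witness a, a unit or 0, such that
a + b and (-)a + c are null; a retract inherits such witnesses, whereas in the
fuzzy ring of formal sums of 1 and e whose ideal consists of the multiples of 1 + e, the sum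
1 + 1 + e + e has none.  So the relations of a fuzzy ring have to be carried by
the multiplication of the system, and the functor has to read them there.

Reading.  Call a sequence of pairs (x_i, x'_i) of units coded if a certain
system of equations in the group, with e as its only constant, has a solution
([coded]).  This is an existential positive condition, so group morphisms
respecting e preserve it.  The functor ([coding_functor]) sends a system to the
fuzzy ring generated by symbols [x], for x a unit, subject to the relations
that the sums of the products [x_i][x'_i] are null for the coded sequences.

Writing.  Given a coherent fuzzy ring Y, the group of [code_graph] encodes all
the null sums of products y_i y'_i of units of Y.  Its generators are
involutions attached to the sites of a graph which is repeated along the
integers, and a translation t moves them.  The generators at two distinct sites
anticommute (x y = e y x) if the sites are adjacent; otherwise their commutator
is an element proper to that pair, and independent of the other commutators.  This is what makes reading possible:
an involution that anticommutes with another one must sit at a single site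
([linked_sites]).  The graph has a vertex for each unit of Y, and for each null
sum a vertex linked, through one node for each factor, to the factors.  Links are
told apart by the distance between the two levels at which they occur, which the
powers of t can measure.  So the sequences that are written are coded
([encode]), and every coded sequence is read as one of them ([decode]).

Retract.  Let [y] denote the generator attached to the unit y.  The relations
force [a][b] = [ab][1], so that y |-> [y][1]^-1 is multiplicative and preserves
null sums, and reading the site of an involution gives a map back
([retract_coding]).

Both steps manipulate a coherent fuzzy ring through its units and their null
sums only, which determine it up to isomorphism of weak morphisms:
[null_structure] lists the properties of these data, and [null_fuzzy_ring]
recovers a fuzzy ring from them. *)

(** * The group of units *)

Definition units (A : absMonoidType) : Type := set_type (@invertible A).

Section Units.
Context {A : absMonoidType}.

HB.instance Definition _ := Choice.on (units A).

Lemma unitP (u : units A) : invertible (val u).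
Proof. by case: u => u /= /set_mem. Qed.

Definition mkunit (a : A) (ha : invertible a) : units A := exist _ a (mem_set ha).

Lemma invertible1 : invertible (1 : A).
Proof. by exists 1; rewrite mulg1. Qed.

Lemma invertibleM (a b : A) : invertible a -> invertible b -> invertible (a * b).
Proof.
move=> [c [ac ca]] [d [bd db]]; exists (d * c).
rewrite -mulgA (mulgA b) bd mul1g ac; split=> //.
by rewrite -mulgA (mulgA c) ca mul1g db.
Qed.

Definition unit_inv (u : units A) : A := xget 0 [set c | val u * c = 1 /\ c * val u = 1].

Lemma unit_invP (u : units A) : val u * unit_inv u = 1 /\ unit_inv u * val u = 1.
Proof. by rewrite /unit_inv; case: xgetP => [c -> //|/= h]; case: (unitP u) => c /h. Qed.

Lemma unit_inv_invertible (u : units A) : invertible (unit_inv u).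
Proof. by exists (val u); case: (unit_invP u). Qed.

Let umul (u v : units A) : units A := mkunit (invertibleM (unitP u) (unitP v)).
Let uone : units A := mkunit invertible1.
Let uinv (u : units A) : units A := mkunit (unit_inv_invertible u).

Fact umulA : associative umul.
Proof. by move=> u v w; apply/val_inj; rewrite /= mulgA. Qed.
Fact umul1 : left_id uone umul.
Proof. by move=> u; apply/val_inj; rewrite /= mul1g. Qed.
Fact umul1r : right_id uone umul.
Proof. by move=> u; apply/val_inj; rewrite /= mulg1. Qed.
Fact umulV : left_inverse uone uinv umul.
Proof. by move=> u; apply/val_inj; case: (unit_invP u). Qed.
Fact umulVr : right_inverse uone uinv umul.
Proof. by move=> u; apply/val_inj; case: (unit_invP u). Qed.

HB.instance Definition _ := isGroup.Build (units A) umulA umul1 umul1r umulV umulVr.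

Lemma val_unitM (u v : units A) : val (u * v) = val u * val v. Proof. by []. Qed.
Lemma val_unit1 : val (1 : units A) = 1. Proof. by []. Qed.

End Units.

(** * Null sums of units *)

Local Notation prods s t := [seq x * y | x <- s, y <- t].

(** What is needed of the sequences of units with null sum in a fuzzy ring.  The
last property merges the fuzzy axioms on products and on distributivity. *)
Record null_structure (G : groupType) (e : G) (N : seq G -> Prop) : Prop := {
  null_nil : N [::];
  null_perm : forall s t, perm_eq s t -> N s -> N t;
  null_cat : forall s t, N s -> N t -> N (s ++ t);
  null_mull : forall g s, N s -> N [seq g * x | x <- s];
  null_mulr : forall g s, N s -> N [seq x * g | x <- s];
  null_negP : forall g, N [:: 1; g] <-> g = e;
  null_unit : ~ N [:: 1];
  null_mul : forall s1 s2 s3 s4, N (s1 ++ s2) -> N (s3 ++ s4) ->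
    N (prods s1 s3 ++ [seq e * x | x <- prods s2 s4])
}.

Section NullTheory.
Context {G : groupType} {e : G} {N : seq G -> Prop}.
Hypothesis nullN : null_structure e N.

Lemma null_neg : N [:: 1; e].
Proof. exact/(null_negP nullN). Qed.

Lemma null_swap g h : N [:: g; h] -> N [:: h; g].
Proof. by apply: (null_perm nullN); rewrite (perm_catC [:: g] [:: h]). Qed.

(** Multiplying by an inverse reduces any null sum of two units to 1 + e. *)
Lemma null_pairP g h : N [:: g; h] <-> h = e * g.
Proof.
split=> [/(null_mulr nullN g^-1)|->]; last first.
  by move/(null_mulr nullN g): null_neg; rewrite /= mul1g.
by rewrite /= mulgV => /(null_negP nullN) <-; rewrite mulgVK.
Qed.

Lemma null_neg2 : e * e = 1.
Proof. by apply/esym/null_pairP/null_swap/null_neg. Qed.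

End NullTheory.

Section FuzzyNull.
Variable F : fuzzy_ring.
Let FP := fuzzy_ringP F.

Definition unull (s : seq (units F)) : Prop := fuzzy_I F (\sum_(u <- s) val u).

Definition ueps : units F :=
  mkunit (ex_intro _ (fuzzy_eps F) (conj (fuzzy_eps2 FP) (fuzzy_eps2 FP))
    : invertible (fuzzy_eps F)).

Lemma with0_unit (u : units F) : with0 invertible (val u).
Proof. by left; apply: unitP. Qed.

Lemma mul_sumr (u : units F) (s : seq (units F)) :
  val u * (\sum_(v <- s) val v) = \sum_(v <- s) val (u * v).
Proof.
rewrite !(big_nth 1) !big_mkord; apply: (gen_suml (fuzzy_gen FP)).
exact: with0_unit.
Qed.

Lemma mul_suml (u : units F) (s : seq (units F)) :
  (\sum_(v <- s) val v) * val u = \sum_(v <- s) val (v * u).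
Proof.
rewrite !(big_nth 1) !big_mkord; apply: (gen_sumr (fuzzy_gen FP)).
exact: with0_unit.
Qed.

(** Iterating the weak distributivity of fuzzy rings: inside a null sum, products
may be expanded. *)
Lemma fuzzy_distr_sum (b c : F) (s : seq (units F)) :
  fuzzy_I F (c + b * (\sum_(v <- s) val v)) ->
  fuzzy_I F (c + \sum_(v <- s) b * val v).
Proof.
elim: s c => [|u s IH] c; first by rewrite !big_nil absorb0r.
rewrite !big_cons => /(fuzzy_distr FP) /IH.
by rewrite Algebra.addrA.
Qed.

Lemma fuzzy_expand (c : F) (s t : seq (units F)) :
  fuzzy_I F (c + (\sum_(u <- s) val u) * (\sum_(v <- t) val v)) ->
  fuzzy_I F (c + \sum_(w <- prods s t) val w).
Proof.
move=> /fuzzy_distr_sum; congr (fuzzy_I F (_ + _)).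
rewrite big_allpairs_dep [RHS]exchange_big /=.
by apply: eq_bigr => v _; rewrite mul_suml.
Qed.

Lemma fuzzy_null : null_structure ueps unull.
Proof.
have idI := fuzzy_ideal FP.
split; rewrite /unull.
- by rewrite big_nil; apply: ideal_0.
- by move=> s t st; rewrite (perm_big t st).
- by move=> s t; rewrite big_cat; apply: ideal_D.
- by move=> g s Ns; rewrite big_map -mul_sumr; apply: ideal_Ml.
- by move=> g s Ns; rewrite big_map -mul_suml; apply: ideal_Mr.
- move=> g; rewrite !big_cons big_nil Algebra.addr0; split.
    by move=> Ng; apply/val_inj/(fuzzy_epsP FP); split=> //; apply: unitP.
  by move=> ->; case/(fuzzy_epsP FP): (erefl (fuzzy_eps F)).
- rewrite big_cons big_nil Algebra.addr0 /= => I1; apply: (ideal_proper idI).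
  apply/seteqP; split=> // b _.
  by rewrite -[b]mulg1; apply: ideal_Ml.
- move=> s1 s2 s3 s4; rewrite !big_cat /= => N1 N2.
  have := fuzzy_mul FP N1 N2; rewrite Algebra.addrC.
  move=> /fuzzy_expand; rewrite Algebra.addrC.
  rewrite -[fuzzy_eps F]/(val ueps) mul_sumr.
  rewrite (_ : \sum_(v <- s2) _ = \sum_(v <- [seq ueps * u | u <- s2]) val v);
    last by rewrite big_map.
  move=> /fuzzy_expand; congr (fuzzy_I F (_ + _)).
  congr (\big[_/_]_(_ <- _) _).
  by rewrite allpairs_mapl map_allpairs; apply: eq_allpairs => x y; rewrite mulgA.
Qed.

End FuzzyNull.

(** * The fuzzy ring of a null structure *)

Section GroupSemiring.
Variable G : groupType.

Definition perm_equiv_rel : equiv_rel (seq G) :=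
  EquivRel perm_eq (@perm_refl G) (@perm_sym G) (@perm_trans G).

(** The semiring N[G] of formal sums; its units are the elements of G, so that a
null structure on G is a set of its elements. *)
Definition group_semiring : Type := {eq_quot perm_equiv_rel}.

HB.instance Definition _ := Choice.on group_semiring.
HB.instance Definition _ := EqQuotient.on group_semiring.

Definition formal (s : seq G) : group_semiring := \pi s.

Lemma formalP s t : formal s = formal t <-> perm_eq s t.
Proof. by split=> [/eqquotP|h]; last exact/eqquotP. Qed.

Lemma formalE (x : group_semiring) : exists s, x = formal s.
Proof. by exists (repr x); rewrite /formal reprK. Qed.

Lemma repr_formal s : perm_eq (repr (formal s)) s.
Proof. by apply/formalP; rewrite /formal reprK. Qed.

(* Addition and multiplication are locked, lest they unify with [formal _]. *)
Let add : group_semiring -> group_semiring -> group_semiring :=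
  locked (fun x y => formal (repr x ++ repr y)).
Let mul : group_semiring -> group_semiring -> group_semiring :=
  locked (fun x y => formal (prods (repr x) (repr y))).

Let addE s t : add (formal s) (formal t) = formal (s ++ t).
Proof. by rewrite /add -lock; apply/formalP/perm_cat; apply: repr_formal. Qed.

Let mulE s t : mul (formal s) (formal t) = formal (prods s t).
Proof. by rewrite /mul -lock; apply/formalP/perm_allpairs; apply: repr_formal. Qed.

Fact addA : associative add.
Proof.
move=> x y z; have [[r ->] [s ->] [t ->]] := And3 (formalE x) (formalE y) (formalE z).
by rewrite !addE catA.
Qed.

Fact addC : commutative add.
Proof.
move=> x y; have [[r ->] [s ->]] := conj (formalE x) (formalE y).
by rewrite !addE; apply/formalP; rewrite perm_catC.
Qed.

Fact add0 : left_id (formal [::]) add.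
Proof. by move=> x; have [s ->] := formalE x; rewrite addE. Qed.

HB.instance Definition _ := Algebra.isNmodule.Build group_semiring addA addC add0.

Lemma prods_mapl (x : G) s t : prods [seq x * y | y <- s] t = [seq x * y | y <- prods s t].
Proof.
rewrite allpairs_mapl map_allpairs; apply: eq_allpairs => y z.
by rewrite mulgA.
Qed.

Lemma prodsA (r s t : seq G) : prods r (prods s t) = prods (prods r s) t.
Proof.
elim: r => //= x r ->; by rewrite allpairs_cat prods_mapl.
Qed.

Lemma prods_unitr s (g : G) : prods s [:: g] = [seq x * g | x <- s].
Proof. by elim: s => //= x s ->. Qed.

Lemma prods_unitl s (g : G) : prods [:: g] s = [seq g * x | x <- s].
Proof. by rewrite /= cats0. Qed.

Fact mulA : associative mul.
Proof.
move=> x y z; have [[r ->] [s ->] [t ->]] := And3 (formalE x) (formalE y) (formalE z).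
by rewrite !mulE prodsA.
Qed.

Fact mul1 : left_id (formal [:: 1]) mul.
Proof.
move=> x; have [s ->] := formalE x; rewrite mulE prods_unitl.
by rewrite (eq_map (@mul1g G)) map_id.
Qed.

Fact mul1r : right_id (formal [:: 1]) mul.
Proof.
move=> x; have [s ->] := formalE x; rewrite mulE prods_unitr.
by rewrite (eq_map (@mulg1 G)) map_id.
Qed.

HB.instance Definition _ := isMonoid.Build group_semiring mulA mul1 mul1r.

Lemma formalD s t : formal s + formal t = formal (s ++ t). Proof. exact: addE. Qed.
Lemma formalM s t : formal s * formal t = formal (prods s t). Proof. exact: mulE. Qed.
Lemma formal0 : (0 : group_semiring) = formal [::]. Proof. by []. Qed.
Lemma formal1 : (1 : group_semiring) = formal [:: 1]. Proof. by []. Qed.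

Fact mul0l (x : group_semiring) : 0 * x = 0.
Proof. by have [s ->] := formalE x; rewrite formal0 formalM. Qed.

Fact mul0r (x : group_semiring) : x * 0 = 0.
Proof.
have [s ->] := formalE x; rewrite formal0 formalM; congr formal.
by elim: s.
Qed.

HB.instance Definition _ := hasAbsorbingZero.Build group_semiring mul0l mul0r.

Lemma formal_sum I (r : seq I) (f : I -> seq G) :
  \sum_(i <- r) formal (f i) = formal (flatten [seq f i | i <- r]).
Proof.
elim: r => [|i r IH]; first by rewrite big_nil.
by rewrite big_cons IH formalD.
Qed.

Lemma formal_distl (x y z : group_semiring) : x * (y + z) = x * y + x * z.
Proof.
have [[r ->] [s ->] [t ->]] := And3 (formalE x) (formalE y) (formalE z).
by rewrite formalD !formalM formalD; apply/formalP; rewrite perm_allpairs_catr.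
Qed.

Lemma formal_distr (x y z : group_semiring) : (y + z) * x = y * x + z * x.
Proof.
have [[r ->] [s ->] [t ->]] := And3 (formalE x) (formalE y) (formalE z).
by rewrite formalD !formalM formalD allpairs_cat.
Qed.

Lemma formal_unit g : invertible (formal [:: g]).
Proof. by exists (formal [:: g^-1]); rewrite !formalM /= mulgV mulVg. Qed.

(** The product of formal sums multiplies their lengths. *)
Lemma formal_unitP (x : group_semiring) :
  invertible x <-> exists g, x = formal [:: g].
Proof.
split=> [[y]|[g ->]]; last exact: formal_unit.
have [[s ->] [t ->]] := conj (formalE x) (formalE y).
rewrite formal1 !formalM => -[/formalP/perm_size + _].
rewrite size_allpairs /= => /eqP; rewrite muln_eq1 => /andP[/eqP].
by case: s => [|g [|]] //= _ _; exists g.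
Qed.

Lemma spans_group_semiring (S : set group_semiring) :
  (forall g, S (formal [:: g])) -> spans S.
Proof.
move=> Sg x; have [s ->] := formalE x.
exists (size s), (fun i => formal [:: nth 1 s i]); split=> //.
rewrite -(big_mkord xpredT (fun i => formal [:: nth 1 s i])).
rewrite -(big_nth 1 xpredT (fun g => formal [:: g])).
rewrite formal_sum; congr formal.
by elim: s => //= g s <-.
Qed.

Lemma group_semiring_gen : gen_ndsemiring (@invertible group_semiring).
Proof.
have sz0 g : formal [:: g] <> 0 by move=> /formalP/perm_size.
split.
- by case/formal_unitP => g /esym/sz0.
- exact: formal_unit.
- move=> a b [ua|->] [ub|->]; rewrite ?absorb0l ?absorb0r; try by right.
  by left; apply: invertibleM.
- by apply: spans_group_semiring => g; left; apply: formal_unit.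
- move=> a n b _; apply: (big_morph (fun x => a * x)); last exact: absorb0r.
  exact: formal_distl.
- move=> a n b _; apply: (big_morph (fun x => x * a)); last exact: absorb0l.
  by move=> y z; apply: formal_distr.
Qed.

Variables (e : G) (N : seq G -> Prop) (nullN : null_structure e N).

Definition null_ideal : set group_semiring := [set x | N (repr x)].

Lemma null_formal s : null_ideal (formal s) <-> N s.
Proof.
by split; apply: (null_perm nullN); rewrite ?repr_formal // perm_sym repr_formal.
Qed.

Lemma null_prods_right (s t : seq G) : N t -> N (prods s t).
Proof.
move=> Nt; elim: s => [|x s IH]; first exact: (null_nil nullN).
by apply: (null_cat nullN) => //; apply: (null_mull nullN).
Qed.

Lemma null_prods_left (s t : seq G) : N s -> N (prods s t).
Proof.
move=> Ns; elim: t => [|x t IH].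
  by rewrite (_ : prods s [::] = [::]); [apply: (null_nil nullN) | elim: (s)].
have /(null_perm nullN) : perm_eq ([seq y * x | y <- s] ++ prods s t) (prods s (x :: t)).
  by rewrite perm_sym perm_allpairs_consr.
by apply; apply: (null_cat nullN) => //; apply: (null_mulr nullN).
Qed.

Lemma group_semiring_fuzzy : fuzzy_axiom (formal [:: e]) null_ideal.
Proof.
split.
- exact: group_semiring_gen.
- split.
  + by apply/null_formal; apply: (null_nil nullN).
  + move=> x y; have [[s ->] [t ->]] := conj (formalE x) (formalE y).
    by rewrite formalD !null_formal; apply: (null_cat nullN).
  + move=> x y; have [[s ->] [t ->]] := conj (formalE x) (formalE y).
    by rewrite formalM !null_formal; apply: null_prods_right.
  + move=> x y; have [[s ->] [t ->]] := conj (formalE x) (formalE y).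
    by rewrite formalM !null_formal; apply: null_prods_left.
  + move=> /seteqP[_ /(_ (formal [:: 1]) I)].
    by move=> /null_formal; apply: null_unit nullN.
- by rewrite formalM /= (null_neg2 nullN).
- move=> x; split=> [->|[/formal_unitP[g ->]]]; rewrite formal1 formalD null_formal /=.
    by split; [exact: formal_unit | apply: null_neg nullN].
  by move=> /(null_negP nullN) ->.
- move=> x y z w.
  have [[r ->] [s ->]] := conj (formalE x) (formalE y).
  have [[t ->] [u ->]] := conj (formalE z) (formalE w).
  rewrite !formalM !formalD !null_formal => Nrs Ntu.
  have := null_mul nullN Nrs Ntu.
  by rewrite -(prodsA [:: e] s u) (prods_unitl (prods s u)).
- by move=> x y z w; rewrite formal_distl Algebra.addrA.
Qed.

Definition null_fuzzy_ring : coherent_fuzzy_ring :=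
  @CoherentFuzzyRing (FuzzyRing group_semiring_fuzzy)
    (spans_group_semiring formal_unit).

Definition funit (g : G) : units null_fuzzy_ring := mkunit (formal_unit g).

Lemma funitM g h : funit (g * h) = funit g * funit h.
Proof. by apply/val_inj; rewrite /= formalM. Qed.

Lemma funit_surj (u : units null_fuzzy_ring) : exists g, u = funit g.
Proof.
have [g ug] := (formal_unitP (val u)).1 (unitP u).
by exists g; apply/val_inj.
Qed.

Lemma funit_inj : injective funit.
Proof.
move=> g h /(congr1 val)/formalP/perm_mem/(_ h).
by rewrite !inE eqxx => /eqP.
Qed.

Lemma unull_funit s : @unull null_fuzzy_ring [seq funit g | g <- s] <-> N s.
Proof.
rewrite /unull big_map -null_formal.
rewrite (_ : \sum_(j <- s) _ = formal s) //.
rewrite /= formal_sum; congr formal.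
by elim: (s) => //= g r ->.
Qed.

End GroupSemiring.

(** * Weak morphisms and group morphisms *)

Section GroupMorphisms.
Context {G H : groupType}.
Variable f : G -> H.
Hypothesis fM : {morph f : x y / x * y}.

Lemma morph1 : f 1 = 1.
Proof. by apply: (mulgI (f 1)); rewrite -fM !mulg1. Qed.

Lemma morphV x : f x^-1 = (f x)^-1.
Proof. by apply/esym/mulg1_eq; rewrite -fM mulgV morph1. Qed.
End GroupMorphisms.

Section WeakHomUnits.
Variables X Y : fuzzy_ring.

Definition fuzzy_hom : Type :=
  weak_hom (@invertible X) (fuzzy_I X) (@invertible Y) (fuzzy_I Y).

Section Make.
Variable f : units X -> units Y.
Hypothesis fM : {morph f : x y / x * y}.
Hypothesis fN : forall s, unull s -> unull [seq f u | u <- s].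

Fact weak_of_mul (a b c : units X) : val c = val a * val b ->
  val (f c) = val (f a) * val (f b).
Proof. by move=> cab; rewrite (_ : c = a * b) ?fM //; apply/val_inj. Qed.

Fact weak_of_null n (a : 'I_n -> units X) :
  fuzzy_I X (\sum_i val (a i)) -> fuzzy_I Y (\sum_i val (f (a i))).
Proof.
rewrite -(big_map a xpredT val) => /fN.
by rewrite /unull !big_map.
Qed.

Definition weak_of : fuzzy_hom := WeakHom weak_of_mul weak_of_null.
End Make.

Variable f : fuzzy_hom.

Lemma weak_homM : {morph (f : units X -> units Y) : x y / x * y}.
Proof. by move=> x y; apply/val_inj; rewrite /= (weak_mul f (val_unitM x y)). Qed.

Lemma weak_hom_unull s : unull s -> unull [seq f u | u <- s].
Proof.
rewrite /unull big_map (big_nth 1) big_mkord => Ns.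
rewrite (big_nth (1 : units X)) big_mkord.
exact: (@weak_null _ _ _ _ _ _ f (size s) (fun i => nth 1 s i)).
Qed.

(** The unit eps is determined by the nullity of 1 + eps. *)
Lemma weak_hom_ueps : f (ueps X) = ueps Y.
Proof.
apply/(null_negP (fuzzy_null Y)).
have := weak_hom_unull (null_neg (fuzzy_null X)).
by rewrite /= (morph1 weak_homM).
Qed.
End WeakHomUnits.

(** * Fuzzy rings defined by generators and relations *)

(** [Some (v, true)] is a generator, [Some (v, false)] its inverse, and [None] is
eps. *)
Definition word (V : Type) : Type := seq (option (V * bool)).
HB.instance Definition _ (V : Type) := gen_eqMixin (word V).
HB.instance Definition _ (V : Type) := gen_choiceMixin (word V).

Section Presentation.
Variables (V : Type) (R : seq (V * V) -> Prop).
Hypothesis R_size : forall xs, R xs -> size xs <> 1%N.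

Implicit Types (w : word V) (s : seq (word V)).

Definition letter (v : V) : word V := [:: Some (v, true)].
Definition rel_word (p : V * V) : word V := letter p.1 ++ letter p.2.
Definition wneg w : word V := None :: w.
Definition word_prods s t : seq (word V) := [seq x ++ y | x <- s, y <- t].

(** The consequences of the relations: the rules are those satisfied by the
sequences of words with null sum in a fuzzy ring.  Equality of words is not a
separate relation, since u = w if and only if u + eps w is null. *)
Inductive derivable : seq (word V) -> Prop :=
| Der_nil : derivable [::]
| Der_perm s t : perm_eq s t -> derivable s -> derivable t
| Der_cat s t : derivable s -> derivable t -> derivable (s ++ t)
| Der_mull w s : derivable s -> derivable [seq w ++ x | x <- s]
| Der_mulr w s : derivable s -> derivable [seq x ++ w | x <- s]
| Der_neg : derivable [:: [::]; wneg [::]]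
| Der_inv v b : derivable [:: [:: Some (v, b); Some (v, ~~ b)]; wneg [::]]
| Der_rel xs : R xs -> derivable [seq rel_word p | p <- xs]
| Der_mul s1 s2 s3 s4 : derivable (s1 ++ s2) -> derivable (s3 ++ s4) ->
    derivable (word_prods s1 s3 ++ [seq wneg x | x <- word_prods s2 s4])
| Der_subst w w' s : derivable [:: w; wneg w'] -> derivable (w :: s) ->
    derivable (w' :: s).

(** Consistency: in the fuzzy ring with one unit where only sums of length 1 are
not null, every relation of length other than 1 holds. *)
Lemma derivable_size s : derivable s -> size s <> 1%N.
Proof.
elim=> {s} //.
- by move=> s t /perm_size ->.
- by move=> s t _ + _; rewrite size_cat; case: (size s) (size t) => [|[]] // [|[]].
- by move=> w s _; rewrite size_map.
- by move=> w s _; rewrite size_map.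
- by move=> xs /R_size; rewrite size_map.
- move=> s1 s2 s3 s4 _ + _; rewrite !size_cat size_map !size_allpairs.
  move: (size s1) (size s2) (size s3) (size s4) => a b c d nab ncd.
  have addn1P m n : m + n = 1%N -> (m == 1%N) && (n == 0%N) || (m == 0%N) && (n == 1%N).
    by case: m n => [|[|m]] [|[|n]].
  move=> /addn1P; rewrite !muln_eq1 !muln_eq0.
  case/orP=> /andP[h1 h2].
    case/andP: h1 => /eqP Ea /eqP Ec.
    by case/orP: h2 => /eqP E; [apply: nab | apply: ncd]; rewrite ?Ea ?Ec E.
  case/andP: h2 => /eqP Eb /eqP Ed.
  by case/orP: h1 => /eqP E; [apply: nab | apply: ncd]; rewrite E ?Eb ?Ed.
Qed.

Definition weq w w' : Prop := derivable [:: w; wneg w'].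

Lemma derivable_swap w w' : derivable [:: w; w'] -> derivable [:: w'; w].
Proof. by apply: Der_perm; rewrite (perm_catC [:: w] [:: w']). Qed.

Lemma derivable_mull2 u w w' :
  derivable [:: w; w'] -> derivable [:: u ++ w; u ++ w'].
Proof. exact: Der_mull. Qed.

Lemma derivable_mulr2 u w w' :
  derivable [:: w; w'] -> derivable [:: w ++ u; w' ++ u].
Proof. exact: Der_mulr. Qed.

Lemma weq_refl w : weq w w.
Proof. exact: (derivable_mulr2 w Der_neg). Qed.

Lemma weq_neg2 w : weq (wneg (wneg w)) w.
Proof.
have /(derivable_mull2 (wneg [::])) := derivable_swap (weq_refl w).
by [].
Qed.

Lemma weq_sym w w' : weq w w' -> weq w' w.
Proof.
move=> /(derivable_mull2 (wneg [::])) /derivable_swap.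
move=> /(Der_subst (weq_neg2 w')); exact.
Qed.

Lemma weq_trans w w' w'' : weq w w' -> weq w' w'' -> weq w w''.
Proof.
move=> /derivable_swap h /(derivable_mull2 (wneg [::])) /Der_subst h'.
exact/derivable_swap/h'/h.
Qed.

Lemma weq_catr u w w' : weq w w' -> weq (w ++ u) (w' ++ u).
Proof. exact: (@derivable_mulr2 u w (wneg w')). Qed.

(** eps is central modulo the relations, by multiplying 1 + eps on either side. *)
Lemma weq_negC u w : weq (u ++ wneg w) (wneg (u ++ w)).
Proof.
have h : weq (u ++ [:: None]) (wneg u).
  have := derivable_mull2 u Der_neg; rewrite cats0.
  by move=> /(Der_subst (weq_sym (weq_neg2 u))) /derivable_swap.
by have := weq_catr w h; rewrite -catA.
Qed.

Lemma weq_catl u w w' : weq w w' -> weq (u ++ w) (u ++ w').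
Proof.
move=> /(derivable_mull2 u) /derivable_swap /(Der_subst (weq_negC u w')).
exact: derivable_swap.
Qed.

Lemma weq_cat u u' w w' : weq u u' -> weq w w' -> weq (u ++ w) (u' ++ w').
Proof. by move=> /(weq_catr w) h /(weq_catl u'); apply: weq_trans. Qed.

Definition winv w : word V := rev [seq omap (fun l => (l.1, ~~ l.2)) x | x <- w].

Lemma winvK : involutive winv.
Proof.
move=> w; rewrite /winv map_rev revK -map_comp -[RHS]map_id.
by apply: eq_map => -[[v b]|] //=; rewrite negbK.
Qed.

Lemma weq_winvr w : weq (w ++ winv w) [::].
Proof.
elim: w => [|l w IH]; first exact: weq_refl.
have -> : (l :: w) ++ winv (l :: w) =
    [:: l] ++ (w ++ winv w) ++ [:: omap (fun l => (l.1, ~~ l.2)) l].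
  by rewrite /winv /= rev_cons -cats1 !catA.
apply: weq_trans (weq_catl _ (weq_catr _ IH)) _.
case: l => [[v b]|]; last exact: weq_neg2.
exact: Der_inv.
Qed.

Lemma weq_winvl w : weq (winv w ++ w) [::].
Proof. by rewrite -{2}[w]winvK; apply: weq_winvr. Qed.

Fact weq_is_equiv : equiv_class_of (fun w w' => `[< weq w w' >]).
Proof.
split=> [w|w w'|w' w w''].
- exact/asboolP/weq_refl.
- by apply/asboolP/asboolP; apply: weq_sym.
- by move=> /asboolP h /asboolP h'; apply/asboolP/weq_trans/h'.
Qed.

Definition weq_equiv_rel : equiv_rel (word V) := EquivRelPack weq_is_equiv.

Definition pres_group : Type := {eq_quot weq_equiv_rel}.
HB.instance Definition _ := Choice.on pres_group.
HB.instance Definition _ := EqQuotient.on pres_group.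

Definition cls w : pres_group := \pi w.

Lemma clsP w w' : cls w = cls w' <-> weq w w'.
Proof. by split=> [/eqquotP/asboolP|h]; last exact/eqquotP/asboolP. Qed.

Lemma clsE (x : pres_group) : exists w, x = cls w.
Proof. by exists (repr x); rewrite /cls reprK. Qed.

Lemma weq_repr w : weq (repr (cls w)) w.
Proof. by apply/clsP; rewrite /cls reprK. Qed.

Let mul : pres_group -> pres_group -> pres_group :=
  locked (fun x y => cls (repr x ++ repr y)).
Let inv : pres_group -> pres_group := locked (fun x => cls (winv (repr x))).

Let mulE w w' : mul (cls w) (cls w') = cls (w ++ w').
Proof. by rewrite /mul -lock; apply/clsP/weq_cat; apply: weq_repr. Qed.

Fact pres_mulA : associative mul.
Proof.
move=> x y z; have [[r ->] [s ->] [t ->]] := And3 (clsE x) (clsE y) (clsE z).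
by rewrite !mulE catA.
Qed.

Fact pres_mul1 : left_id (cls [::]) mul.
Proof. by move=> x; have [w ->] := clsE x; rewrite mulE. Qed.

Fact pres_mul1r : right_id (cls [::]) mul.
Proof. by move=> x; have [w ->] := clsE x; rewrite mulE cats0. Qed.

Fact pres_mulV : left_inverse (cls [::]) inv mul.
Proof.
move=> x; rewrite /inv -lock; have [w ->] := clsE x.
rewrite mulE; apply/clsP/weq_trans/weq_winvl.
exact/weq_catl/weq_sym/weq_repr.
Qed.

Fact pres_mulVr : right_inverse (cls [::]) inv mul.
Proof.
move=> x; rewrite /inv -lock; have [w ->] := clsE x.
rewrite mulE; apply/clsP/weq_trans/weq_winvr.
exact/weq_catr/weq_sym/weq_repr.
Qed.

HB.instance Definition _ :=
  isGroup.Build pres_group pres_mulA pres_mul1 pres_mul1r pres_mulV pres_mulVr.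

Lemma clsM w w' : cls w * cls w' = cls (w ++ w'). Proof. exact: mulE. Qed.

Definition pres_null (s : seq pres_group) : Prop := derivable [seq repr x | x <- s].

(** The substitutions are done one at a time, each term being moved to the head. *)
Lemma derivable_weq (f g : word V -> word V) s :
  (forall w, weq (f w) (g w)) ->
  derivable [seq f w | w <- s] -> derivable [seq g w | w <- s].
Proof.
move=> fg; rewrite -[X in derivable X -> _]cats0 -[X in _ -> derivable X]cats0.
elim: s [::] => //= w s IH r /(Der_subst (fg w)).
move=> /(@Der_perm _ ([seq f w | w <- s] ++ g w :: r)) h.
have /IH : derivable ([seq f w | w <- s] ++ g w :: r).
  by apply: h; rewrite perm_sym -[g w :: r]cat1s perm_catCA.
by apply: Der_perm; rewrite -[g w :: r]cat1s perm_catCA.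
Qed.

Lemma pres_null_cls s : pres_null [seq cls w | w <- s] <-> derivable s.
Proof.
rewrite /pres_null -map_comp -[X in _ <-> derivable X]map_id.
split; apply: derivable_weq => w; first exact: weq_repr.
exact/weq_sym/weq_repr.
Qed.

Lemma map_clsE (s : seq pres_group) : exists t, s = [seq cls w | w <- t].
Proof.
exists [seq repr x | x <- s]; rewrite -map_comp -[LHS]map_id.
by apply: eq_map => x; rewrite /= /cls reprK.
Qed.

Definition pres_eps : pres_group := cls [:: None].

Lemma prods_cls s t :
  prods [seq cls w | w <- s] [seq cls w | w <- t] = [seq cls w | w <- word_prods s t].
Proof.
rewrite map_allpairs allpairs_mapl allpairs_mapr.
by apply: eq_allpairs => w w'; rewrite clsM.
Qed.

Lemma pres_nullP : null_structure pres_eps pres_null.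
Proof.
split.
- exact: Der_nil.
- by move=> s t st; apply: Der_perm; apply: perm_map.
- by move=> s t; rewrite /pres_null map_cat; apply: Der_cat.
- move=> g s; have [w ->] := clsE g; have [t ->] := map_clsE s.
  rewrite pres_null_cls => /(Der_mull w) /pres_null_cls.
  by rewrite -!map_comp; congr pres_null; apply: eq_map => x; rewrite /= clsM.
- move=> g s; have [w ->] := clsE g; have [t ->] := map_clsE s.
  rewrite pres_null_cls => /(Der_mulr w) /pres_null_cls.
  by rewrite -!map_comp; congr pres_null; apply: eq_map => x; rewrite /= clsM.
- move=> g; have [w ->] := clsE g.
  rewrite -[[:: 1; _]]/[seq cls w | w <- [:: [::]; w]] pres_null_cls clsP.
  split=> [|/derivable_swap]; last exact: Der_subst (weq_neg2 [::]).
  by move=> /(Der_subst (weq_sym (weq_neg2 [::]))); apply: derivable_swap.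
- by move=> /derivable_size; apply.
- move=> s1 s2 s3 s4.
  have [t1 ->] := map_clsE s1; have [t2 ->] := map_clsE s2.
  have [t3 ->] := map_clsE s3; have [t4 ->] := map_clsE s4.
  rewrite -!map_cat !pres_null_cls !prods_cls => h /(Der_mul h) /pres_null_cls.
  rewrite map_cat -[X in _ ++ X]map_comp -[X in _ -> pres_null (_ ++ X)]map_comp.
  by congr (pres_null (_ ++ _)); apply: eq_map => w; rewrite /= clsM.
Qed.

Section Eval.
Context {G : groupType} {e : G} {N : seq G -> Prop}.
Hypothesis nullN : null_structure e N.
Variable phi : V -> G.

Definition lev (l : option (V * bool)) : G :=
  if l is Some (v, b) then if b then phi v else (phi v)^-1 else e.

Definition wev w : G := foldr (fun l g => lev l * g) 1 w.

Lemma wev_cat w w' : wev (w ++ w') = wev w * wev w'.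
Proof. by elim: w => [|l w IH] /=; rewrite ?mul1g // IH mulgA. Qed.

Hypothesis phiR : forall xs, R xs -> N [seq phi p.1 * phi p.2 | p <- xs].

Lemma wev_word_prods s t : [seq wev w | w <- word_prods s t] =
  prods [seq wev w | w <- s] [seq wev w | w <- t].
Proof.
rewrite map_allpairs allpairs_mapl allpairs_mapr.
by apply: eq_allpairs => w w'; rewrite wev_cat.
Qed.

(** Soundness of the rules. *)
Lemma derivable_null s : derivable s -> N [seq wev w | w <- s].
Proof.
elim=> {s}.
- exact: null_nil nullN.
- by move=> s t st _; apply: (null_perm nullN); apply: perm_map.
- by move=> s t _ Ns _ Nt; rewrite map_cat; apply: (null_cat nullN).
- move=> w s _ /(null_mull nullN (wev w)); rewrite -!map_comp.
  by congr N; apply: eq_map => x; rewrite /= wev_cat.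
- move=> w s _ /(null_mulr nullN (wev w)); rewrite -!map_comp.
  by congr N; apply: eq_map => x; rewrite /= wev_cat.
- by rewrite /= mulg1; apply: null_neg nullN.
- move=> v b; rewrite /= !mulg1; case: b; rewrite /= ?mulgV ?mulVg;
  exact: null_neg nullN.
- move=> xs /phiR; rewrite -map_comp; congr N.
  by apply: eq_map => p; rewrite /= mulg1.
- move=> s1 s2 s3 s4 _ + _; rewrite !map_cat => N1 N2.
  have E r : [seq e * x | x <- [seq wev w | w <- r]] =
      [seq wev w | w <- [seq wneg w | w <- r]] by rewrite -!map_comp.
  by have := null_mul nullN N1 N2; rewrite -!wev_word_prods E.
- move=> w w' s _ /= h _; move/(null_pairP nullN): h => /mulgI ->.
  by [].
Qed.

Lemma wev_weq w w' : weq w w' -> wev w = wev w'.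
Proof. by move=> /derivable_null /= /(null_pairP nullN) /mulgI ->. Qed.

Definition pres_ev (x : pres_group) : G := wev (repr x).

Lemma pres_ev_cls w : pres_ev (cls w) = wev w.
Proof. exact/wev_weq/weq_repr. Qed.

Lemma pres_evM : {morph pres_ev : x y / x * y}.
Proof.
move=> x y; have [[w ->] [w' ->]] := conj (clsE x) (clsE y).
by rewrite clsM !pres_ev_cls wev_cat.
Qed.

Lemma pres_ev_null (s : seq pres_group) : pres_null s -> N [seq pres_ev x | x <- s].
Proof.
have [t ->] := map_clsE s; rewrite pres_null_cls => /derivable_null.
by rewrite -map_comp; congr N; apply: eq_map => w; rewrite /= pres_ev_cls.
Qed.

End Eval.

Definition pres_ring : coherent_fuzzy_ring := null_fuzzy_ring pres_nullP.

Definition pres_unit (w : word V) : units pres_ring := funit pres_nullP (cls w).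

Definition pres_gen (v : V) : units pres_ring := pres_unit (letter v).

Lemma pres_unitM w w' : pres_unit (w ++ w') = pres_unit w * pres_unit w'.
Proof. by rewrite -funitM clsM. Qed.

Lemma pres_unit1 : pres_unit [::] = 1.
Proof. exact: morph1 (funitM pres_nullP). Qed.

Lemma pres_unit_eps : pres_unit [:: None] = ueps pres_ring.
Proof. exact/val_inj. Qed.

Lemma pres_unit_surj (u : units pres_ring) : exists w, u = pres_unit w.
Proof. by have [x ->] := funit_surj u; have [w ->] := clsE x; exists w. Qed.

Lemma pres_gen_rel xs : R xs ->
  unull [seq pres_gen p.1 * pres_gen p.2 | p <- xs].
Proof.
move=> /Der_rel /pres_null_cls /(unull_funit pres_nullP).
by rewrite -!map_comp; congr unull; apply: eq_map => p; rewrite /= -pres_unitM.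
Qed.

Section Lift.
Variables (Y : fuzzy_ring) (phi : V -> units Y).
Hypothesis phiR : forall xs, R xs -> unull [seq phi p.1 * phi p.2 | p <- xs].

Definition unfunit (u : units pres_ring) : pres_group := sval (cid (funit_surj u)).

Lemma unfunitK u : funit pres_nullP (unfunit u) = u.
Proof. by rewrite /unfunit; case: cid. Qed.

Lemma funitK x : unfunit (funit pres_nullP x) = x.
Proof. by apply: (@funit_inj _ _ _ pres_nullP); rewrite unfunitK. Qed.

Definition lift_fun (u : units pres_ring) : units Y :=
  pres_ev (e := ueps Y) phi (unfunit u).

Fact lift_funM : {morph lift_fun : x y / x * y}.
Proof.
move=> x y; rewrite /lift_fun -(pres_evM (fuzzy_null Y) phiR); congr pres_ev.
by rewrite -[in LHS](unfunitK x) -[in LHS](unfunitK y) -funitM funitK.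
Qed.

Fact lift_fun_null (s : seq (units pres_ring)) : unull s -> unull [seq lift_fun u | u <- s].
Proof.
have [t ->] : exists t, s = [seq funit pres_nullP x | x <- t].
  exists [seq unfunit u | u <- s]; rewrite -map_comp -[LHS]map_id.
  by apply: eq_map => u; rewrite /= unfunitK.
move=> /unull_funit /(pres_ev_null (fuzzy_null Y) phiR).
by rewrite -map_comp; congr unull; apply: eq_map => x; rewrite /lift_fun /= funitK.
Qed.

Definition pres_lift : fuzzy_hom pres_ring Y := weak_of lift_funM lift_fun_null.

Lemma pres_lift_gen v : pres_lift (pres_gen v) = phi v.
Proof.
rewrite /= /lift_fun funitK (pres_ev_cls (fuzzy_null Y) phiR) /=.
by rewrite mulg1.
Qed.
End Lift.

(** The generators generate the group of units together with eps. *)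
Lemma pres_hom_ext (Y : fuzzy_ring) (f g : fuzzy_hom pres_ring Y) :
  (forall v, f (pres_gen v) = g (pres_gen v)) -> f = g.
Proof.
move=> fg; apply: weak_hom_eq => u; have [w ->] := pres_unit_surj u.
elim: w => [|l w IH].
  by rewrite pres_unit1 (morph1 (weak_homM f)) (morph1 (weak_homM g)).
rewrite -cat1s pres_unitM !weak_homM IH.
suff -> : f (pres_unit [:: l]) = g (pres_unit [:: l]) by [].
case: l => [[v b]|]; last first.
  by rewrite pres_unit_eps !weak_hom_ueps.
case: b; first exact: fg.
have -> : pres_unit [:: Some (v, false)] = (pres_gen v)^-1.
  apply/esym/mulg1_eq; rewrite -pres_unitM -pres_unit1.
  by congr funit; apply/clsP/(Der_inv v true).
by rewrite (morphV (weak_homM f)) (morphV (weak_homM g)) fg.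
Qed.

End Presentation.

(** * A hyper-type system with a prescribed group of units *)

(** [CNonzero] stands for the subset H, and [CAll] for the union of H and 0. *)
Inductive coarse (H : Type) := CZero | CUnit of H | CNonzero | CAll.
Arguments CZero {H}.
Arguments CNonzero {H}.
Arguments CAll {H}.

(** Bundled, because the laws of [coarse_field] rest on these properties. *)
Record signed_group := SignedGroup {
  signed_carrier :> groupType;
  gneg : signed_carrier;
  gnegC : forall x, x * gneg = gneg * x;
  gneg2 : gneg * gneg = 1;
  gneg_neq1 : gneg <> 1
}.
Arguments gneg : clear implicits.

Definition coarse_field (H : signed_group) : Type := coarse H.

Section CoarseField.
Variable H : signed_group.

HB.instance Definition _ := gen_eqMixin (coarse_field H).
HB.instance Definition _ := gen_choiceMixin (coarse_field H).

Let e : H := gneg H.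
Let eC (x : H) : x * e = e * x := gnegC x.
Let e2 : e * e = 1 := gneg2 H.
Let e_neq1 : e <> 1 := @gneg_neq1 H.
Let K := coarse_field H.

Let add (a b : K) : K :=
  match a, b with
  | CZero, c | c, CZero => c
  | CUnit x, CUnit y => if y == e * x then CAll else CNonzero
  | _, _ => CAll
  end.

Let mul (a b : K) : K :=
  match a, b with
  | CZero, _ | _, CZero => CZero
  | CUnit x, CUnit y => CUnit (x * y)
  | CAll, _ | _, CAll => CAll
  | _, _ => CNonzero
  end.

Fact coarse_addA : associative add.
Proof. by case=> [|x||] [|y||] [|z||] //=; do ?case: eqP. Qed.

Fact coarse_addC : commutative add.
Proof.
case=> [|x||] [|y||] //=.
suff -> : (y == e * x) = (x == e * y) by [].
by apply/eqP/eqP => ->; rewrite mulgA e2 mul1g.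
Qed.

Fact coarse_add0 : left_id (CZero : K) add.
Proof. by case. Qed.

HB.instance Definition _ :=
  Algebra.isNmodule.Build (coarse_field H) coarse_addA coarse_addC coarse_add0.

Fact coarse_mulA : associative mul.
Proof. by case=> [|x||] [|y||] [|z||] //=; rewrite mulgA. Qed.

Fact coarse_mul1 : left_id (CUnit 1 : K) mul.
Proof. by case=> [|x||] //=; rewrite mul1g. Qed.

Fact coarse_mul1r : right_id (CUnit 1 : K) mul.
Proof. by case=> [|x||] //=; rewrite mulg1. Qed.

HB.instance Definition _ :=
  isMonoid.Build (coarse_field H) coarse_mulA coarse_mul1 coarse_mul1r.

Fact coarse_mul0 (b : K) : 0 * b = 0. Proof. by []. Qed.
Fact coarse_mul0r (b : K) : b * 0 = 0. Proof. by case: b. Qed.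

HB.instance Definition _ :=
  hasAbsorbingZero.Build (coarse_field H) coarse_mul0 coarse_mul0r.

Lemma coarse_addE (a b : K) : a + b = add a b. Proof. by []. Qed.
Lemma coarse_mulE (a b : K) : a * b = mul a b. Proof. by []. Qed.

Definition coarse_unit (x : H) : K := CUnit x.

Lemma coarse_invertible (x : H) : invertible (coarse_unit x).
Proof.
by exists (coarse_unit x^-1); rewrite !coarse_mulE /= mulgV mulVg.
Qed.

Lemma coarse_invertibleP (a : K) : invertible a <-> exists x, a = coarse_unit x.
Proof.
split=> [[b]|[x ->]]; last exact: coarse_invertible.
rewrite !coarse_mulE; case: a => [|x||]; case: b => [|y||] //= [] // _ _.
by exists x.
Qed.

Lemma coarse_with0P (a : K) :
  with0 invertible a <-> a = 0 \/ exists x, a = coarse_unit x.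
Proof.
split=> [[/coarse_invertibleP|->]|[->|/coarse_invertibleP]];
  by [right | left | right | left].
Qed.

Definition coarse_neg (a : K) : K :=
  if a is CUnit x then CUnit (e * x) else a.

(** The inclusion of the subsets that the elements stand for. *)
Definition coarse_le (a b : K) : Prop :=
  match b with
  | CAll => True
  | CNonzero => if a is CUnit _ then True else a = CNonzero
  | _ => a = b
  end.

Lemma coarse_leD (a b c d : K) :
  coarse_le a c -> coarse_le b d -> coarse_le (a + b) (c + d).
Proof.
rewrite !coarse_addE.
case: a => [|x||]; case: b => [|y||]; case: c => [|z||]; case: d => [|t||] //= ac bd;
  by do ?[case: ac => ?; subst | case: bd => ?; subst]; do ?case: ifP.
Qed.

Lemma coarse_leM (a b c d : K) :
  coarse_le a c -> coarse_le b d -> coarse_le (a * b) (c * d).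
Proof.
rewrite !coarse_mulE.
case: a => [|x||]; case: b => [|y||]; case: c => [|z||]; case: d => [|t||] //= ac bd;
  by do ?[case: ac => ?; subst | case: bd => ?; subst].
Qed.

Lemma coarse_le_refl a : coarse_le a a.
Proof. by case: a. Qed.

Lemma coarse_le_trans b a c : coarse_le a b -> coarse_le b c -> coarse_le a c.
Proof.
case: a => [|x||]; case: b => [|y||]; case: c => [|z||] //= ab bc;
  by do ?[case: ab => ?; subst | case: bc => ?; subst].
Qed.

Lemma coarse_gen : gen_ndsemiring (@invertible K).
Proof.
have distl (a b c : K) : with0 invertible a -> a * (b + c) = a * b + a * c.
  rewrite !coarse_mulE !coarse_addE.
  move=> /coarse_with0P[->//|[x ->]]; case: b => [|y||]; case: c => [|z||] //=.
  suff -> : (x * z == e * (x * y)) = (z == e * y) by case: ifP.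
  by rewrite (mulgA e x y) -(eC x) -mulgA (inj_eq (mulgI x)).
have distr (a b c : K) : with0 invertible a -> (b + c) * a = b * a + c * a.
  rewrite !coarse_mulE !coarse_addE.
  move=> /coarse_with0P[->|[x ->]]; case: b => [|y||]; case: c => [|z||] //=.
    by case: ifP.
  suff -> : (z * x == e * (y * x)) = (z == e * y) by case: ifP.
  by rewrite mulgA (inj_eq (mulIg x)).
split.
- by move=> /coarse_invertibleP[].
- exact: invertible1.
- move=> a b [ua|->] [ub|->]; rewrite ?absorb0l ?absorb0r; try by right.
  by left; apply: invertibleM.
- have sp1 (a : K) : with0 invertible a -> exists n (f : 'I_n -> K),
     (forall i, with0 invertible (f i)) /\ a = \sum_i f i.
    by move=> ?; exists 1%N, (fun=> a); rewrite big_ord1.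
  have sp2 (a b : K) : with0 invertible a -> with0 invertible b ->
      exists n (f : 'I_n -> K), (forall i, with0 invertible (f i)) /\ a + b = \sum_i f i.
    move=> ? ?; exists 2%N, (fun i => if i == ord0 then a else b).
    by rewrite big_ord_recl big_ord1; split=> // i; case: ifP.
  have u (x : H) : with0 invertible (coarse_unit x) by left; apply: coarse_invertible.
  case=> [|x||].
  + by apply: sp1; right.
  + exact: sp1.
  + have := sp2 _ _ (u 1) (u 1); rewrite coarse_addE /= mulg1.
    by case: eqP => // /esym.
  + by have := sp2 _ _ (u 1) (u e); rewrite coarse_addE /= mulg1 eqxx.
- move=> a n b a0; apply: (big_morph (fun x => a * x)); last exact: absorb0r.
  by move=> x y; apply: distl.
- move=> a n b a0; apply: (big_morph (fun x => x * a)); last exact: absorb0l.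
  by move=> x y; apply: distr.
Qed.

Lemma coarse_negation : negation_map (@invertible K) coarse_neg.
Proof.
have negMl (a b : K) : invertible a -> coarse_neg (a * b) = coarse_neg a * b.
  by case/coarse_invertibleP=> x ->; case: b => [|y||] //=; rewrite !coarse_mulE /= mulgA.
have negMr (a b : K) : invertible a -> coarse_neg (b * a) = b * coarse_neg a.
  case/coarse_invertibleP=> x ->; case: b => [|y||] //=; rewrite !coarse_mulE /=.
  by rewrite !mulgA eC.
split=> //.
- case=> [|x||]; case=> [|y||] //=; rewrite !coarse_addE //=.
  suff -> : (e * y == e * (e * x)) = (y == e * x) by case: ifP.
  by rewrite (inj_eq (mulgI e)).
- by case=> [|x||] //=; rewrite mulgA e2 mul1g.
- exact: coarse_invertible.
- by move=> a b /negMl.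
- move=> a b /coarse_invertibleP[x ->]; case: b => [|y||] //=; rewrite !coarse_mulE /=.
  by rewrite !mulgA eC.
- by move=> a b /negMr.
- move=> a b /coarse_invertibleP[x ->]; case: b => [|y||] //=; rewrite !coarse_mulE /=.
  by rewrite mulgA.
Qed.

Lemma coarse_system : nd_system_axiom (@invertible K) coarse_neg coarse_le.
Proof.
split.
- split; [exact: coarse_gen | exact: coarse_negation |].
  move=> b /coarse_invertibleP[x]; rewrite /quasi_zero coarse_addE.
  by case: b => [|y||] //=; rewrite eqxx.
- split.
  + exact: coarse_le_refl.
  + by move=> b c d; apply: coarse_le_trans.
  + by case.
  + by move=> b; rewrite /quasi_zero coarse_addE; case: b => [|y||] //=; rewrite eqxx.
  + by move=> a1 a2 b1 b2 c1 c2 _ _ h1 h2; apply: coarse_leD; apply: coarse_leM;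
      rewrite ?coarse_le_refl //; apply: coarse_le_refl.
  + by move=> a1 a2 b1 b2 c1 c2 _ _ h1 h2; apply: coarse_leD; apply: coarse_leM;
      rewrite ?coarse_le_refl //; apply: coarse_le_refl.
  + by move=> b1 b2 c1 c2; apply: coarse_leM.
  + by move=> a a' _ /coarse_with0P[->|[x ->]].
- move=> a a' /coarse_invertibleP[x ->] /coarse_invertibleP[y ->].
  rewrite /Null /= coarse_addE /=; case: eqP => [/mulgI-> //|_].
  by [].
Qed.

(** Sums are sums of subsets: a member of b + c comes from members of b and c.
With [coarse_splitM], this is what the hyper-type property amounts to. *)
Lemma coarse_splitD (a b c : K) : with0 invertible a -> coarse_le a (b + c) ->
  exists b' c', [/\ with0 invertible b' /\ coarse_le b' b,
    with0 invertible c' /\ coarse_le c' c & coarse_le a (b' + c')].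
Proof.
have w0 : with0 invertible (0 : K) by right.
have wu x : with0 invertible (coarse_unit x) by left; apply: coarse_invertible.
have add0 (d : K) : d + 0 = d by rewrite Algebra.addr0.
move=> wa; case: b => [|y||]; last first.
- case: c => [|z||] le.
  + by exists a, 0; rewrite add0; split; [split | split | exact: coarse_le_refl].
  + exists (coarse_unit (e * z)), (coarse_unit z); split=> //; rewrite coarse_addE /=.
    by rewrite mulgA e2 mul1g eqxx.
  + exists (coarse_unit e), (coarse_unit 1); split=> //; rewrite coarse_addE /=.
    by rewrite e2 eqxx.
  + exists (coarse_unit e), (coarse_unit 1); split=> //; rewrite coarse_addE /=.
    by rewrite e2 eqxx.
- case: c => [|z||] le.
  + by exists a, 0; rewrite add0; split; [split | split | exact: coarse_le_refl].
  + exists (coarse_unit (e * z)), (coarse_unit z); split=> //; rewrite coarse_addE /=.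
    by rewrite mulgA e2 mul1g eqxx.
  + exists (coarse_unit e), (coarse_unit 1); split=> //; rewrite coarse_addE /=.
    by rewrite e2 eqxx.
  + exists (coarse_unit e), (coarse_unit 1); split=> //; rewrite coarse_addE /=.
    by rewrite e2 eqxx.
- case: c => [|z||] le.
  + by exists (coarse_unit y), 0.
  + by exists (coarse_unit y), (coarse_unit z).
  + exists (coarse_unit y), (coarse_unit (e * y)); split=> //.
    by rewrite coarse_addE /= eqxx.
  + exists (coarse_unit y), (coarse_unit (e * y)); split=> //.
    by rewrite coarse_addE /= eqxx.
- move=> le; exists 0, a; rewrite Algebra.add0r.
  by split; [split | split | exact: coarse_le_refl].
Qed.

Lemma coarse_splitM (a b c : K) : with0 invertible a -> coarse_le a (b * c) ->
  exists b' c', [/\ with0 invertible b' /\ coarse_le b' b,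
    with0 invertible c' /\ coarse_le c' c & a = b' * c'].
Proof.
have w0 : with0 invertible (0 : K) by right.
have wu x : with0 invertible (coarse_unit x) by left; apply: coarse_invertible.
move=> /coarse_with0P[->|[x ->]] le; last first.
  case: b le => [|y||]; case: c => [|z||] //= le.
  - by exists (coarse_unit y), (coarse_unit z).
  - exists (coarse_unit y), (coarse_unit (y^-1 * x)); split=> //.
    by rewrite coarse_mulE /= mulVKg.
  - exists (coarse_unit y), (coarse_unit (y^-1 * x)); split=> //.
    by rewrite coarse_mulE /= mulVKg.
  - exists (coarse_unit (x * z^-1)), (coarse_unit z); split=> //.
    by rewrite coarse_mulE /= mulgVK.
  - exists (coarse_unit x), (coarse_unit 1); split=> //.
    by rewrite coarse_mulE /= mulg1.
  - exists (coarse_unit x), (coarse_unit 1); split=> //.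
    by rewrite coarse_mulE /= mulg1.
  - exists (coarse_unit (x * z^-1)), (coarse_unit z); split=> //.
    by rewrite coarse_mulE /= mulgVK.
  - exists (coarse_unit x), (coarse_unit 1); split=> //.
    by rewrite coarse_mulE /= mulg1.
  - exists (coarse_unit x), (coarse_unit 1); split=> //.
    by rewrite coarse_mulE /= mulg1.
have below (d : K) : exists d', with0 invertible d' /\ coarse_le d' d.
  by case: d => [|y||]; [exists 0 | exists (coarse_unit y)
    | exists (coarse_unit 1) | exists 0].
have [b' b'P] := below b; have [c' c'P] := below c.
case: b le b'P => [|y||]; case: c c'P => [|z||] //= c'P le b'P.
all: try by exists 0, c'.
all: try by exists b', 0; rewrite absorb0r.
Qed.

Lemma coarse_split_sum n (f : 'I_n -> K) (a : K) :
  with0 invertible a -> coarse_le a (\sum_i f i) ->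
  exists g : 'I_n -> K, (forall i, with0 invertible (g i) /\ coarse_le (g i) (f i)) /\
    coarse_le a (\sum_i g i).
Proof.
elim: n f a => [|n IH] f a wa; first by move=> le; exists f; split=> // -[].
rewrite big_ord_recl => /(coarse_splitD wa)[b [c [bP [wc cP] le]]].
have [g [gP leg]] := IH _ c wc cP.
exists (fun i => if unlift ord0 i is Some j then g j else b); split.
  by move=> i; case: (unliftP ord0 i) => [j ->|->].
rewrite big_ord_recl unlift_none.
under eq_bigr do rewrite liftK.
exact/(coarse_le_trans le)/(coarse_leD (coarse_le_refl b) leg).
Qed.

Lemma coarse_hyper_type : hyper_type (@invertible K) coarse_le.
Proof.
move=> n b b'; rewrite /Null /=; set s := \sum_i _ => le.
have [g [gP leg]] := coarse_split_sum (or_intror erefl) le.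
have /choice[h hP] : forall i, exists p : K * K,
    [/\ with0 invertible p.1 /\ coarse_le p.1 (b i),
      with0 invertible p.2 /\ coarse_le p.2 (b' i) & g i = p.1 * p.2].
  move=> i; have [wg lg] := gP i.
  by have [x [y xy]] := coarse_splitM wg lg; exists (x, y).
exists (fun i => (h i).1), (fun i => (h i).2); split=> [i|i|].
- by case: (hP i) => -[? _] [? _].
- by case: (hP i) => -[_ ?] [_ ?].
- move: leg; rewrite /Null /=.
  by rewrite (eq_bigr (fun i => (h i).1 * (h i).2)) // => i _; case: (hP i).
Qed.

Definition coarse_hyper_system : hyper_system :=
  @HyperSystem (NdSystem coarse_system) coarse_hyper_type erefl.

Definition coarse_units (x : H) : units K := mkunit (coarse_invertible x).

Lemma coarse_units_surj (u : units K) : exists x, u = coarse_units x.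
Proof.
have /coarse_invertibleP[x ux] := unitP u.
by exists x; apply/val_inj.
Qed.

Lemma coarse_units_inj : injective coarse_units.
Proof. by move=> x y [->]. Qed.

End CoarseField.

(** * Reading relations in a group *)

(** An injective numbering of the positions, here with the length n of the
sequence: without n, the first positions of a longer sequence would be read as
a sequence.  Distances up to 3 serve other purposes. *)
Definition offset (n i : nat) (b : bool) : nat := (choice.pickle (n, i, b)).+4.

Section Coded.
Context {G : groupType}.
Variable e : G.

Definition linked (x y : G) : Prop := x * y = e * (y * x).

Definition factor (p : G * G) (b : bool) : G := if b then p.2 else p.1.

(** The unknown z stands for the relation, p i b for the occurrence of the
factor b of the i-th product.  The marker y is there to bound t: in the groups
used below, an involution can anticommute with its conjugate by t only if t
translates by one level, up or down.  Then two elements that anticommute, and do so again after one of them is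
translated by m levels, are linked at two levels at distance m.  The distance 3
links the node p i b to the factor. *)
Record coding (xs : seq (G * G)) (t y z : G) (p : nat -> bool -> G) : Prop := {
  cod_marker : y * y = 1 /\ linked y (y ^ t);
  cod_center : z * z = 1;
  cod_node : forall i b, i < size xs -> p i b * p i b = 1;
  cod_entry : forall i b, i < size xs ->
    factor (nth (1, 1) xs i) b * factor (nth (1, 1) xs i) b = 1;
  cod_center_node : forall i b, i < size xs ->
    linked z (p i b) /\ linked z (p i b ^ (t ^+ (offset (size xs) i b)));
  cod_node_entry : forall i b, i < size xs ->
    linked (p i b) (factor (nth (1, 1) xs i) b) /\
    linked (p i b) (factor (nth (1, 1) xs i) b ^ (t ^+ 3))
}.

Definition coded (xs : seq (G * G)) : Prop :=
  1 < size xs /\ exists t y z p, coding xs t y z p.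

Lemma coded_size xs : coded xs -> size xs <> 1%N.
Proof. by case=> + _ h; rewrite h. Qed.

End Coded.

Section CodedMorphism.
Context {G H : groupType}.
Variables (e : G) (f : G -> H).
Hypothesis fM : {morph f : x y / x * y}.

Lemma morphX x n : f (x ^+ n) = f x ^+ n.
Proof. by elim: n => [|n IH]; rewrite ?expg0 ?(morph1 fM) // !expgS fM IH. Qed.

Lemma morphJ x y : f (x ^ y) = f x ^ f y.
Proof. by rewrite !conjgE !fM (morphV fM). Qed.

Lemma coded_morph (xs : seq (G * G)) :
  coded e xs -> coded (f e) [seq (f p.1, f p.2) | p <- xs].
Proof.
have fl x y : linked e x y -> linked (f e) (f x) (f y).
  by rewrite /linked -!fM => ->.
have f2 x : x * x = 1 -> f x * f x = 1 by rewrite -fM => ->; rewrite morph1.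
case=> sz [t [y [z [p [[y2 yt] z2 p2 x2 zp px]]]]].
split; first by rewrite size_map.
exists (f t), (f y), (f z), (fun i b => f (p i b)).
have ffactor i b : i < size xs ->
    factor (nth (1, 1) [seq (f p.1, f p.2) | p <- xs] i) b = f (factor (nth (1, 1) xs i) b).
  by move=> ilt; rewrite (nth_map (1, 1)) //; case: b.
split; rewrite ?size_map.
- by rewrite -morphJ; split; [apply: f2 | apply: fl].
- exact: f2.
- by move=> i b ilt; apply/f2/p2.
- by move=> i b ilt; rewrite ffactor //; apply/f2/x2.
- by move=> i b ilt; rewrite -morphX -morphJ; case: (zp i b ilt) => h1 h2; split; apply: fl.
- move=> i b ilt; rewrite ffactor // -morphX -morphJ.
  by case: (px i b ilt) => h1 h2; split; apply: fl.
Qed.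
End CodedMorphism.

(** * The functor *)

Section HyperUnits.
Variable X : hyper_system.

Lemma hyper_TP (a : X) : system_T X a <-> invertible a.
Proof. by rewrite (hyper_invertible X). Qed.

Definition toT (u : units X) : system_T X :=
  exist _ (val u) (mem_set ((hyper_TP _).2 (unitP u))).

Definition ofT (u : system_T X) : units X :=
  mkunit ((hyper_TP _).1 (set_mem (valP u))).

Lemma ofTK u : toT (ofT u) = u. Proof. exact/val_inj. Qed.

Lemma neg1_invertible : invertible (system_neg X 1).
Proof. exact/hyper_TP/(neg_one (triple_neg (system_triple (system_axiom X)))). Qed.

Definition neg1 : units X := mkunit neg1_invertible.

End HyperUnits.

Section HyperHom.
Variables X Y : hyper_system.
Variable f : weak_hom (system_T X) (Null (system_le X)) (system_T Y) (Null (system_le Y)).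

Definition hyper_fun (u : units X) : units Y := ofT (f (toT u)).

Lemma hyper_funM : {morph hyper_fun : u v / u * v}.
Proof. by move=> u v; apply/val_inj; rewrite /= (weak_mul f (a := toT u) (b := toT v)). Qed.

(** As in fuzzy rings, 1 (-) 1 is null and negations are unique. *)
Lemma hyper_fun_neg1 : hyper_fun (neg1 X) = neg1 Y.
Proof.
have negX := triple_neg (system_triple (system_axiom X)).
have negY := triple_neg (system_triple (system_axiom Y)).
pose u := hyper_fun (neg1 X).
have null : Null (system_le Y) (1 + val u).
  have := weak_null f (a := fun i : 'I_2 => if i == ord0 then toT 1 else toT (neg1 X)).
  rewrite !big_ord_recl !big_ord0 /= !Algebra.addr0.
  have -> : val (f (toT 1)) = 1.
    by rewrite -[RHS]val_unit1 -(morph1 hyper_funM).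
  apply; exact: (surp_quasi (system_surp (system_axiom X))).
have T1 : system_T Y 1 by apply/hyper_TP/invertible1.
have Tu : system_T Y (system_neg Y (val u)).
  apply/hyper_TP; rewrite -[val u]mul1g -(neg_mulTl negY) //.
  by apply: invertibleM; [apply: neg1_invertible | apply: unitP].
have nu : 1 = system_neg Y (val u).
  apply: (system_uniq_neg (system_axiom Y)) => //.
  by rewrite (neg_invol negY).
by apply/val_inj; rewrite /= nu (neg_invol negY).
Qed.

End HyperHom.

Definition coding_ring (X : hyper_system) : coherent_fuzzy_ring :=
  pres_ring (@coded_size _ (neg1 X)).

Section CodingMap.
Variables (X Y : hyper_system) (f : @hom hyper_systems X Y).

Let gen (u : units X) : units (coding_ring Y) :=
  pres_gen (@coded_size _ (neg1 Y)) (hyper_fun f u).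

Fact coding_rel (xs : seq (units X * units X)) : coded (neg1 X) xs ->
  unull [seq gen p.1 * gen p.2 | p <- xs].
Proof.
move=> /(coded_morph (hyper_funM f)); rewrite hyper_fun_neg1.
by move=> /(pres_gen_rel (@coded_size _ (neg1 Y))); rewrite -map_comp.
Qed.

Definition coding_map : @hom wFR (coding_ring X) (coding_ring Y) :=
  pres_lift (phi := gen) (@coded_size _ (neg1 X)) coding_rel.

Lemma coding_map_gen u : coding_map (pres_gen _ u) =
  pres_gen (@coded_size _ (neg1 Y)) (hyper_fun f u).
Proof. exact: pres_lift_gen. Qed.
End CodingMap.

Definition coding_functor : functor hyper_systems wFR.
Proof.
refine (@Functor hyper_systems wFR coding_ring coding_map _ _).
- move=> X; apply: pres_hom_ext => u; rewrite coding_map_gen /=.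
  by congr pres_gen; apply/val_inj.
- move=> X Y Z g f; apply: pres_hom_ext => u.
  transitivity (coding_map g (coding_map f (pres_gen (@coded_size _ (neg1 X)) u)));
    last by [].
  rewrite !coding_map_gen; congr pres_gen.
  by apply/val_inj; rewrite /hyper_fun ofTK.
Defined.

(** * The group of a graph repeated along the integers *)

Local Notation "\xor_ ( i <- r ) F" := (\big[addb/false]_(i <- r) F)
  (at level 41, F at level 41, i, r at level 50).

(** A vertex of the graph and a level. *)
Definition site (V : Type) : Type := (V * Z)%type.
HB.instance Definition _ (V : Type) := gen_eqMixin (site V).
HB.instance Definition _ (V : Type) := gen_choiceMixin (site V).

Section Sites.
Variable V : Type.
Let S : eqType := site V.

Definition raise (k : Z) (v : S) : S := (v.1, (v.2 + k)%Z).

Lemma raise0 v : raise 0 v = v.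
Proof. by case: v => x q; rewrite /raise /= Z.add_0_r. Qed.

Lemma raiseD j k v : raise j (raise k v) = raise (j + k) v.
Proof. by rewrite /raise /=; congr pair; lia. Qed.

Lemma raiseK k v : raise (- k) (raise k v) = v.
Proof. by rewrite raiseD Z.add_opp_diag_l raise0. Qed.

Lemma raiseVK k v : raise k (raise (- k) v) = v.
Proof. by rewrite raiseD Z.add_opp_diag_r raise0. Qed.

Lemma raise_inj k : injective (raise k).
Proof. exact: can_inj (raiseK k). Qed.

Definition parity (l : seq S) (u : S) : bool := \xor_(v <- l) (v == u).

Lemma parity_cat l l' u : parity (l ++ l') u = parity l u (+) parity l' u.
Proof. by rewrite /parity big_cat. Qed.

Lemma parity1 v u : parity [:: v] u = (v == u).
Proof. by rewrite /parity big_seq1. Qed.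

Lemma parity_cons v l u : parity (v :: l) u = (v == u) (+) parity l u.
Proof. by rewrite /parity big_cons. Qed.

Lemma parity_rev l u : parity (rev l) u = parity l u.
Proof. by rewrite /parity; apply: perm_big; rewrite perm_rev. Qed.

Lemma parity_raise k l u : parity [seq raise k v | v <- l] u = parity l (raise (- k) u).
Proof.
rewrite /parity big_map; apply: eq_bigr => v _.
by rewrite -[u in LHS](raiseVK k) (inj_eq (@raise_inj k)).
Qed.

(** Both sides count the occurrences in l of each site of s, modulo 2. *)
Lemma xor_parity_sub (g : S -> bool) l s : uniq s -> {subset l <= s} ->
  \xor_(v <- l) g v = \xor_(u <- s) (parity l u && g u).
Proof.
move=> us ls; under [RHS]eq_bigr do rewrite /parity big_distrl.
rewrite exchange_big /=; apply: eq_big_seq => v /ls vs.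
by rewrite (bigD1_seq v) //= eqxx big1 ?addbF // => u; rewrite eq_sym => /negPf->.
Qed.

Lemma eq_xor_parity (g : S -> bool) l l' : parity l =1 parity l' ->
  \xor_(v <- l) g v = \xor_(v <- l') g v.
Proof.
move=> ll'; have us := undup_uniq (l ++ l').
rewrite (xor_parity_sub g us) => [|v vl]; last by rewrite mem_undup mem_cat vl.
rewrite (@xor_parity_sub g l' _ us) => [|v vl]; last by rewrite mem_undup mem_cat vl orbT.
by apply: eq_bigr => u _; rewrite ll'.
Qed.

End Sites.

(** The graphs are bipartite, which rules out triangles, and oriented.  Finite
out-neighbourhoods make [flow] below meaningful for every function. *)
Record site_graph (V : Type) := SiteGraph {
  out : site V -> seq (site V);
  color : site V -> bool;
  out_uniq : forall v, uniq (out v);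
  out_raise : forall k v, perm_eq (out (raise k v)) [seq raise k w | w <- out v];
  out_color : forall v w, w \in out v -> color w = ~~ color v
}.

Section SiteGroup.
Variables (V : Type) (gr : site_graph V).
Let S : eqType := site V.

Definition arrow (v w : S) : bool := w \in out gr v.
Definition adj (v w : S) : bool := arrow v w (+) arrow w v.
Definition far (v w : S) : bool := (v != w) && ~~ adj v w.

Lemma arrow_raise k v w : arrow (raise k v) (raise k w) = arrow v w.
Proof. by rewrite /arrow (perm_mem (out_raise gr k v)) mem_map //; apply: raise_inj. Qed.

Lemma far_raise k v w : far (raise k v) (raise k w) = far v w.
Proof. by rewrite /far /adj !arrow_raise (inj_eq (@raise_inj _ k)). Qed.

Lemma adj_sym v w : adj v w = adj w v.
Proof. exact: addbC. Qed.

Lemma adj_color v w : adj v w -> color gr w = ~~ color gr v.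
Proof.
rewrite /adj; case: (boolP (arrow v w)) => [/out_color //|_].
by rewrite addFb => /out_color ->; rewrite negbK.
Qed.

Lemma arrow_irrefl v : arrow v v = false.
Proof. by apply/negP => /out_color; case: (color gr v). Qed.

(** The group acts on configurations (s, a, m) made of a sign, a function on
sites and a function on pairs of sites.  The flip at v changes a at v, the sign
according to the values of a at the out-neighbours of v, and the entries
m v w, for w far from v, according to a w.  So s records the order of the flips
at adjacent sites, while m records it separately for each pair of far ones. *)
Definition config : Type := (bool * (S -> bool) * (S -> S -> bool))%type.

Definition flow (v : S) (a : S -> bool) : bool := \xor_(w <- out gr v) a w.

Lemma flowD v a b : flow v (fun w => a w (+) b w) = flow v a (+) flow v b.
Proof. exact: big_split. Qed.

Lemma flow0 v : flow v xpred0 = false.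
Proof. by rewrite /flow big1. Qed.

Lemma flow1 v w : flow v (fun u => u == w) = arrow v w.
Proof.
rewrite /flow /arrow; case: (boolP (w \in out gr v)) => [wv|wv].
  by rewrite (bigD1_seq w) ?out_uniq //= eqxx big1 // => u /negPf.
by rewrite big_seq big1 // => u uv; apply: contraNF wv => /eqP <-.
Qed.

Lemma flow_parity v l : flow v (parity l) = \xor_(w <- l) arrow v w.
Proof.
rewrite /flow /parity exchange_big /=; apply: eq_bigr => w _.
by rewrite -flow1 /flow; apply: eq_bigr => u _; rewrite eq_sym.
Qed.

Lemma eq_flow v a b : a =1 b -> flow v a = flow v b.
Proof. by move=> ab; apply: eq_bigr => w _. Qed.

Definition flip (v : S) (c : config) : config :=
  let: (s, a, m) := c in
  (s (+) flow v a, fun u => a u (+) (u == v),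
   fun u w => m u w (+) ((u == v) && far u w && a w)).

Definition sign (b : bool) (c : config) : config :=
  let: (s, a, m) := c in (s (+) b, a, m).

Definition shift (k : Z) (c : config) : config :=
  let: (s, a, m) := c in
  (s, fun u => a (raise (- k) u), fun u w => m (raise (- k) u) (raise (- k) w)).

Lemma config_eq (s s' : bool) (a a' : S -> bool) (m m' : S -> S -> bool) :
  s = s' -> a =1 a' -> m =2 m' -> (s, a, m) = (s', a', m') :> config.
Proof.
move=> -> /funext -> mm'; congr (_, _).
by apply/funext => u; apply/funext => w; apply: mm'.
Qed.

Lemma flipK v : involutive (flip v).
Proof.
move=> [[s a] m] /=; apply: config_eq => [|u|u w].
- by rewrite flowD flow1 arrow_irrefl addbF addbK.
- by rewrite addbK.
- rewrite -addbA -[RHS]addbF; congr (_ (+) _).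
  case: (u =P v) => //= ->; case: (w =P v) => [->|_]; last by rewrite addbF addbb.
  by rewrite /far eqxx.
Qed.

Lemma flip_shift k v c : shift k (flip v c) = flip (raise k v) (shift k c).
Proof.
case: c => [[s a] m] /=; apply: config_eq => [|u|u w].
- congr addb; rewrite /flow (perm_big _ (out_raise gr k v)) big_map.
  by apply: eq_bigr => w _; rewrite raiseK.
- by rewrite -(inj_eq (@raise_inj _ k)) raiseVK.
- by rewrite -(inj_eq (@raise_inj _ k)) -(far_raise k) !raiseVK.
Qed.

Lemma flip_sign b v c : sign b (flip v c) = flip v (sign b c).
Proof. by case: c => [[s a] m] /=; rewrite addbAC. Qed.

Lemma shift_sign b k c : sign b (shift k c) = shift k (sign b c).
Proof. by case: c => [[s a] m]. Qed.

Lemma shiftD j k c : shift j (shift k c) = shift (j + k) c.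
Proof.
case: c => [[s a] m] /=; have E u : raise (- k) (raise (- j) u) = raise (- (j + k)) u :> S.
  by rewrite raiseD; congr raise; lia.
by apply: config_eq => // [u|u w]; rewrite !E.
Qed.

Lemma shift0 c : shift 0 c = c.
Proof. by case: c => [[s a] m] /=; apply: config_eq => // [u|u w]; rewrite !raise0. Qed.

Definition flips (l : seq S) (c : config) : config := foldr flip c l.

Lemma flips_cat l l' c : flips (l ++ l') c = flips l (flips l' c).
Proof. by rewrite /flips foldr_cat. Qed.

Lemma flips_shift k l c : shift k (flips l c) = flips [seq raise k v | v <- l] (shift k c).
Proof. by elim: l => //= v l <-; rewrite flip_shift. Qed.

Lemma flips_sign b l c : sign b (flips l c) = flips l (sign b c).
Proof. by elim: l => //= v l <-; rewrite flip_sign. Qed.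

Lemma flipsK l c : flips (rev l) (flips l c) = c.
Proof.
elim: l c => // v l IH c; rewrite rev_cons -cats1 flips_cat /=.
by rewrite flipK IH.
Qed.

Definition site_map (b : bool) (l : seq S) (k : Z) : config -> config :=
  fun c => sign b (flips l (shift k c)).

Lemma site_mapM b l k b' l' k' :
  site_map b l k \o site_map b' l' k' =
  site_map (b (+) b') (l ++ [seq raise k v | v <- l']) (k + k').
Proof.
apply/funext => c; rewrite /site_map /= -shift_sign flips_shift shiftD.
rewrite -flips_sign flips_cat; set d := flips l _.
by case: d => [[s a] m] /=; rewrite -addbA (addbC b').
Qed.

Lemma site_map1 : site_map false [::] 0 = id.
Proof. by apply/funext => c; rewrite /site_map /= shift0; case: c => [[s a] m] /=; rewrite addbF. Qed.

Definition site_group : Type :=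
  {f : config -> config | exists b l k, f = site_map b l k}.
HB.instance Definition _ := gen_eqMixin site_group.
HB.instance Definition _ := gen_choiceMixin site_group.

Definition site_elt b l k : site_group :=
  exist _ (site_map b l k) (ex_intro _ b (ex_intro _ l (ex_intro _ k erefl))).

Lemma site_val_inj (g h : site_group) : sval g = sval h -> g = h.
Proof. by case: g h => [g gP] [h hP] /= gh; subst h; congr exist; apply: Prop_irrelevance. Qed.

Lemma site_eltE (g : site_group) : exists b l k, g = site_elt b l k.
Proof. by case: (g) => f [b [l [k fE]]]; exists b, l, k; apply: site_val_inj. Qed.

Fact site_mul_subproof (g h : site_group) :
  exists b l k, sval g \o sval h = site_map b l k.
Proof.
have [[b [l [k ->]]] [b' [l' [k' ->]]]] := conj (svalP g) (svalP h).
by rewrite site_mapM; do 3 eexists.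
Qed.

Definition site_mul (g h : site_group) : site_group := exist _ _ (site_mul_subproof g h).

Lemma site_mulE b l k b' l' k' : site_mul (site_elt b l k) (site_elt b' l' k') =
  site_elt (b (+) b') (l ++ [seq raise k v | v <- l']) (k + k').
Proof. by apply: site_val_inj; apply: site_mapM. Qed.

Lemma site_map_invl b l k :
  site_map b [seq raise (- k) v | v <- rev l] (- k) \o site_map b l k = id.
Proof.
rewrite site_mapM -map_cat addbb Z.add_opp_diag_l; apply/funext => c.
rewrite /site_map shift0 -[in flips _ c](shift0 c).
rewrite (_ : shift 0 c = shift (- k) (shift k c)); last by rewrite shiftD Z.add_opp_diag_l.
rewrite -flips_shift flips_cat flipsK shiftD Z.add_opp_diag_l shift0.
by case: c => [[s a] m] /=; rewrite addbF.
Qed.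

Fact site_inv_subproof (g : site_group) : exists h : site_group, sval h \o sval g = id.
Proof.
have [b [l [k ->]]] := svalP g.
by exists (site_elt b [seq raise (- k) v | v <- rev l] (- k)); apply: site_map_invl.
Qed.

Definition site_inv (g : site_group) : site_group := sval (cid (site_inv_subproof g)).

Fact site_mulA : associative site_mul.
Proof. by move=> f g h; apply: site_val_inj. Qed.

Let one := site_elt false [::] 0.

Fact site_mul1 : left_id one site_mul.
Proof. by move=> g; apply: site_val_inj; rewrite /= site_map1. Qed.

Fact site_mul1r : right_id one site_mul.
Proof. by move=> g; apply: site_val_inj; rewrite /= site_map1. Qed.

Fact site_mulV : left_inverse one site_inv site_mul.
Proof.
move=> g; apply: site_val_inj; rewrite /= site_map1 /site_inv.
by case: cid.
Qed.

Fact site_mulVr : right_inverse one site_inv site_mul.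
Proof.
move=> g; rewrite -[LHS]site_mul1 -{1}(site_mulV (site_inv g)).
by rewrite -site_mulA (site_mulA (site_inv g)) site_mulV site_mul1 site_mulV.
Qed.

HB.instance Definition _ :=
  isGroup.Build site_group site_mulA site_mul1 site_mul1r site_mulV site_mulVr.

Lemma site_eltM b l k b' l' k' : site_elt b l k * site_elt b' l' k' =
  site_elt (b (+) b') (l ++ [seq raise k v | v <- l']) (k + k').
Proof. exact: site_mulE. Qed.

Lemma site_eltV b l k :
  (site_elt b l k)^-1 = site_elt b [seq raise (- k) v | v <- rev l] (- k).
Proof.
rewrite -[RHS]invgK; congr inv; apply/esym/mulg1_eq; apply: site_val_inj.
by rewrite [RHS]site_map1; apply: site_map_invl.
Qed.

Definition site_neg : site_group := site_elt true [::] 0.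
Definition site_flip (v : S) : site_group := site_elt false [:: v] 0.
Definition site_shift (k : Z) : site_group := site_elt false [::] k.

Lemma site_negC (g : site_group) : g * site_neg = site_neg * g.
Proof.
have [b [l [k ->]]] := site_eltE g; rewrite !site_eltM /= cats0 addbC Z.add_comm.
by congr site_elt; rewrite -[LHS]map_id; apply: eq_map => v; rewrite raise0.
Qed.

Lemma site_neg2 : site_neg * site_neg = 1.
Proof. by rewrite site_eltM. Qed.

Lemma site_neg_neq1 : site_neg <> 1.
Proof.
by move=> /(congr1 (fun g => (sval g (false, xpred0, fun=> xpred0)).1.1)).
Qed.

Lemma site_flip2 v : site_flip v * site_flip v = 1.
Proof.
rewrite site_eltM; apply: site_val_inj; rewrite /= site_map1.
apply/funext => c; rewrite /site_map /= raise0 shift0 flipK.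
by case: c => [[s a] m] /=; rewrite addbF.
Qed.

Lemma site_shiftX k n : site_shift k ^+ n = site_shift (Z.of_nat n * k).
Proof.
elim: n => [|n IH]; first by [].
rewrite expgS IH site_eltM; congr site_elt.
by rewrite Nat2Z.inj_succ Z.mul_succ_l Z.add_comm.
Qed.

(** With [site_flip_linked], this produces solutions of equations. *)
Lemma site_flip_conj n v :
  site_flip v ^ (site_shift (-1) ^+ n) = site_flip (raise (Z.of_nat n) v).
Proof.
rewrite site_shiftX conjgE; apply: (mulgI (site_shift (Z.of_nat n * -1))).
rewrite mulVKg !site_eltM /= raiseD.
have -> : (Z.of_nat n * -1 + Z.of_nat n = 0)%Z by lia.
by rewrite raise0 Z.add_0_r.
Qed.

Lemma site_flip_linked v w : adj v w ->
  linked site_neg (site_flip v) (site_flip w).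
Proof.
move=> vw; rewrite /linked !site_eltM; apply: site_val_inj; apply/funext => c.
rewrite /= /site_map /= !raise0 shift0; case: c => [[s a] m].
apply: config_eq => [|u|u x].
- rewrite !flowD !flow1 !addbF -!addbA; congr addb.
  move: vw; rewrite /adj; move: (flow v a) (flow w a) (arrow v w) (arrow w v).
  by do 4 case.
- by rewrite addbAC.
- have K p q : adj p q -> (u == p) && far u x && (a x (+) (x == q)) = (u == p) && far u x && a x.
    move=> pq; case: (u =P p) => [->|//]; case: (x =P q) => [->|_]; last by rewrite addbF.
    by rewrite /far pq !andbF.
  by rewrite (K v w vw) (K w v) 1?adj_sym //; exact: addbAC.
Qed.

(** If l and l' list the flips in g and h, the commutator of g and h acts on the
sign by pairing l l' + pairing l' l, and g * g by pairing l l. *)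
Definition pairing (l l' : seq S) : bool := \xor_(v <- l) flow v (parity l').

Lemma pairingE l l' : pairing l l' = \xor_(v <- l) \xor_(w <- l') arrow v w.
Proof. by apply: eq_bigr => v _; rewrite flow_parity. Qed.

Lemma eq_pairing l1 l2 l1' l2' : parity l1 =1 parity l2 -> parity l1' =1 parity l2' ->
  pairing l1 l1' = pairing l2 l2'.
Proof.
move=> e e'; rewrite /pairing (eq_xor_parity _ e).
by apply: eq_bigr => v _; apply: eq_flow.
Qed.

Fixpoint flips_sign_part (l : seq S) : bool :=
  if l is v :: l' then flips_sign_part l' (+) flow v (parity l') else false.

Fixpoint flips_far_part (l : seq S) (u w : S) : bool :=
  if l is v :: l'
  then flips_far_part l' u w (+) ((u == v) && far u w && parity l' w) else false.

(** The only dependence on the configuration is through the flow of a along l and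
the products of the parities of l with a. *)
Lemma flipsE l s a m : flips l (s, a, m) =
  (s (+) \xor_(v <- l) flow v a (+) flips_sign_part l,
   fun u => a u (+) parity l u,
   fun u w => m u w (+) (far u w && parity l u && a w) (+) flips_far_part l u w).
Proof.
elim: l => [|v l IH].
  apply: config_eq => [|u|u w] /=.
  - by rewrite big_nil !addbF.
  - by rewrite /parity big_nil addbF.
  - by rewrite /parity big_nil andbF !addbF.
rewrite /= IH; apply: config_eq => [|u|u w].
- rewrite big_cons flowD -!addbA; congr addb.
  move: (\big[_/_]_(_ <- _) _) (flow v a) (flips_sign_part l) (flow v _).
  by do 4 case.
- by rewrite parity_cons (eq_sym v) -addbA (addbC (parity l u)).
- rewrite parity_cons (eq_sym v) -!addbA; congr addb.
  move: (far u w) (parity l u) (a w) (flips_far_part l u w) (u == v) (parity l w).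
  by do 6 case.
Qed.

Definition rep (g : site_group) (l : seq S) (k : Z) : Prop :=
  exists b, g = site_elt b l k.

Lemma repM g h l k l' k' : rep g l k -> rep h l' k' ->
  rep (g * h) (l ++ [seq raise k v | v <- l']) (k + k').
Proof. by move=> [b ->] [b' ->]; rewrite site_eltM; eexists. Qed.

Lemma repV g l k : rep g l k -> rep g^-1 [seq raise (- k) v | v <- rev l] (- k).
Proof. by move=> [b ->]; rewrite site_eltV; eexists. Qed.

Lemma repX g l k n : rep g l k -> exists l', rep (g ^+ n) l' (Z.of_nat n * k).
Proof.
move=> gl; elim: n => [|n [l' IH]]; first by exists [::], false.
exists (l ++ [seq raise k v | v <- l']).
rewrite expgS Nat2Z.inj_succ Z.mul_succ_l Z.add_comm.
exact: repM.
Qed.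

(** An element at the site v is not determined by v: conjugating a flip changes
signs and entries of m. *)
Definition at_site (g : site_group) (v : S) : Prop :=
  exists2 l, rep g l 0 & parity l =1 (fun u => v == u).

Lemma at_site_flip v : at_site (site_flip v) v.
Proof. by exists [:: v]; [exists false | apply: parity1]. Qed.

Lemma rep0_eval g l : rep g l 0 ->
  exists s m, sval g (false, xpred0, fun=> xpred0) = (s, parity l, m).
Proof.
move=> [b ->]; rewrite /= /site_map shift0 flipsE /=; do 2 eexists.
exact: config_eq.
Qed.

(** The parities are read off the image of the zero configuration. *)
Lemma at_site_uniq g v w : at_site g v -> at_site g w -> v = w.
Proof.
move=> [l /rep0_eval[s [m E]] lv] [l' /rep0_eval[s' [m' E']] l'w].
have [_ /(congr1 (fun f => f v)) + _] : (s, parity l, m) = (s', parity l', m') by rewrite -E -E'.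
by rewrite lv l'w eqxx => /esym/eqP.
Qed.

Lemma at_site_conj p v t l k : at_site p v -> rep t l k -> at_site (p ^ t) (raise (- k) v).
Proof.
move=> [l' pl' l'v] tl; have := repM (repV tl) (repM pl' tl).
rewrite -conjgE Z.add_0_l Z.add_opp_diag_l; set l0 := (l0 in rep _ l0 _) => h.
exists l0 => // u; rewrite /l0 {h l0}.
rewrite parity_cat !parity_raise parity_rev Z.opp_involutive parity_cat.
rewrite parity_raise Z.opp_0 raise0 l'v addbCA addbb addbF.
by rewrite -(inj_eq (@raise_inj _ (- k))) raiseK.
Qed.

(** An involution cannot translate, since the integers have no torsion. *)
Lemma invol_level (v0 : S) g l k : rep g l k -> g * g = 1 -> k = 0%Z.
Proof.
move=> [b ->]; rewrite site_eltM => /(congr1 (@sval _ _)) /=; rewrite site_map1 => E.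
pose ev (a : S -> bool) := (site_map (b (+) b) (l ++ [seq raise k v | v <- l]) (k + k)
  (false, a, fun=> xpred0)).1.2.
have evE a : ev a = a by rewrite /ev E.
have evF a u : ev a u = a (raise (- (k + k)) u) (+) parity (l ++ [seq raise k v | v <- l]) u.
  by rewrite /ev /site_map /= flipsE.
have par0 u : parity (l ++ [seq raise k v | v <- l]) u = false.
  by have := evF xpred0 u; rewrite evE.
have := evF (fun u => u == v0) v0; rewrite evE par0 addbF eqxx => /esym/eqP.
by case: (v0) => x q [] ; lia.
Qed.

(** If g had two far sites u and w, its two actions would change m u w by values
of a w that differ.  The second property is read off the sign. *)
Lemma invol_clique g l : rep g l 0 -> g * g = 1 ->
  (forall u w, far u w -> parity l u -> parity l w -> False) /\ pairing l l = false.
Proof.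
move=> [b ->]; rewrite site_eltM => /(congr1 (@sval _ _)) /=; rewrite site_map1.
rewrite addbb (eq_map (@raise0 V)) map_id => /(congr1 (fun f => f (false, xpred0, fun=> xpred0))).
rewrite /site_map shift0 flips_cat !flipsE /= => E.
split=> [u w uw lu lw|].
  have /(congr1 (fun c => c.2 u w)) := E; rewrite /= uw lu lw /=.
  by case: (flips_far_part l u w).
have /(congr1 (fun c => c.1.1)) := E; rewrite /= -/(pairing l l).
rewrite big1 => [|v _]; last exact: flow0.
by case: (flips_sign_part l) (pairing l l) => -[].
Qed.

Lemma linked_pairing g h l l' : rep g l 0 -> rep h l' 0 -> linked site_neg g h ->
  pairing l l' (+) pairing l' l.
Proof.
move=> [b ->] [b' ->]; rewrite /linked !site_eltM /= !(eq_map (@raise0 V)) !map_id.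
move=> /(congr1 (fun g => (sval g (false, xpred0, fun=> xpred0)).1.1)) /=.
rewrite /site_map !shift0 !flips_cat !flipsE /= -/(pairing l l') -/(pairing l' l).
rewrite !big1 => [|v _|v _]; try exact: flow0.
by case: b b' (flips_sign_part l) (flips_sign_part l') (pairing l l') (pairing l' l)
  => [] [] [] [] [] [].
Qed.

Lemma pairing0 l l' : parity l =1 xpred0 -> pairing l l' = false /\ pairing l' l = false.
Proof.
move=> l0; split.
  rewrite (@eq_pairing l [::] l' l') => // [|u]; first by rewrite /pairing big_nil.
  by rewrite l0 /parity big_nil.
by rewrite /pairing big1 // => v _; rewrite (eq_flow v l0) flow0.
Qed.

(** The sites form a clique; as there are no triangles it has at most two sites,
and the sign of the square of a product of two anticommuting flips is e. *)
Lemma single_site l u0 :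
  (forall u w, far u w -> parity l u -> parity l w -> False) ->
  pairing l l = false -> parity l u0 -> exists v, parity l =1 (fun u => v == u).
Proof.
move=> clique l2 lu0.
have adjl u w : u != w -> parity l u -> parity l w -> adj u w.
  move=> uw lu lw; apply: contraT => nuw; case: (clique u w) => //.
  by rewrite /far uw.
have [[w [wu0 lw]]|no] := pselect (exists w, u0 != w /\ parity l w); last first.
  exists u0 => u; case: eqP => [<- //|/eqP uu0]; apply/negP => lu.
  by apply: no; exists u.
have uw := adjl _ _ wu0 lu0 lw.
have lE : parity l =1 parity [:: u0; w].
  move=> u; rewrite parity_cons parity1.
  case: (u0 =P u) => [<-|/eqP u0u]; first by rewrite lu0 eq_sym (negPf wu0).
  case: (w =P u) => [<- //|/eqP wu]; apply/negP => lu.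
  have := adj_color (adjl _ _ u0u lu0 lu); have := adj_color (adjl _ _ wu lw lu).
  by rewrite (adj_color uw) => ->; case: (color gr u0).
move: l2; rewrite (eq_pairing lE lE) pairingE !big_cons !big_nil !addbF.
by rewrite !arrow_irrefl !addbF addFb -/(adj u0 w) uw.
Qed.

(** An element without sites has zero pairings, so it does not anticommute with
any other; [single_site] applies to the others. *)
Lemma linked_sites (v0 : S) g h : g * g = 1 -> h * h = 1 -> linked site_neg g h ->
  exists v w, [/\ at_site g v, at_site h w & adj v w].
Proof.
move=> g2 h2 gh.
have zero x : x * x = 1 -> exists l, rep x l 0.
  move=> x2; have [b [l [k xE]]] := site_eltE x.
  have xr : rep x l k by exists b.
  by exists l; rewrite -(invol_level v0 xr x2).
have [l gl] := zero g g2; have [l' hl'] := zero h h2.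
have ll' := linked_pairing gl hl' gh.
have single x r r' : rep x r 0 -> x * x = 1 -> pairing r r' (+) pairing r' r ->
    exists v, parity r =1 (fun u => v == u).
  move=> xr x2 rr'; have [clique r2] := invol_clique xr x2.
  have [[u ru]|no] := pselect (exists u, parity r u); first exact: single_site ru.
  have r0 : parity r =1 xpred0 by move=> u; apply/negP => ru; apply: no; exists u.
  by case: (pairing0 r' r0) rr' => -> ->.
have [v lv] := single _ _ _ gl g2 ll'.
have [w l'w] := single _ _ _ hl' h2 (etrans (addbC _ _) ll').
exists v, w; split; [by exists l | by exists l' |].
have e1 u : parity l u = parity [:: v] u by rewrite lv parity1.
have e2 u : parity l' u = parity [:: w] u by rewrite l'w parity1.
move: ll'; rewrite (eq_pairing e1 e2) (eq_pairing e2 e1) !pairingE !big_seq1.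
by [].
Qed.

End SiteGroup.

(** * Writing relations in a graph *)

Section CodeGraph.
Variables (U : groupType) (valid : seq (U * U) -> Prop).

(** An element of U, a sequence of pairs, and the positions in such a sequence;
the marker makes the unit translation recognizable. *)
Inductive vertex :=
| Entry of U | Center of seq (U * U) | Node of seq (U * U) & nat & bool | Marker.

Definition positions (xs : seq (U * U)) : seq (nat * bool) :=
  [seq (i, b) | i <- iota 0 (size xs), b <- [:: false; true]].

(** Every link occurs at two levels; their distance is the type of the link. *)
Definition levels (n : nat) : seq nat := locked [:: 0%N; n].

Lemma levelsP n d : (d \in levels n) = (d == 0%N) || (d == n).
Proof. by rewrite /levels -lock !inE. Qed.

(** The arrows go from the sequence to its nodes and from these to the factors. *)
Definition steps (v : site vertex) : seq (site vertex) :=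
  match v.1 with
  | Entry _ => [::]
  | Center xs => if `[< valid xs >] then
      [seq (Node xs p.1 p.2, (v.2 + Z.of_nat d)%Z) | p <- positions xs,
         d <- levels (offset (size xs) p.1 p.2)] else [::]
  | Node xs i b =>
      [seq (Entry (factor (nth (1, 1) xs i) b), (v.2 + Z.of_nat d)%Z) | d <- levels 3]
  | Marker => [:: (Marker, (v.2 + 1)%Z)]
  end.

Definition code_out (v : site vertex) : seq (site vertex) := undup (steps v).

(** The last argument is the difference of the levels. *)
Inductive step : vertex -> vertex -> Z -> Prop :=
| StepCenter xs i b d : valid xs -> i < size xs ->
    d \in levels (offset (size xs) i b) ->
    step (Center xs) (Node xs i b) (Z.of_nat d)
| StepNode xs i b d : d \in levels 3 ->
    step (Node xs i b) (Entry (factor (nth (1, 1) xs i) b)) (Z.of_nat d)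
| StepMarker : step Marker Marker 1.

Lemma positionsP xs i b : ((i, b) \in positions xs) = (i < size xs).
Proof.
apply/allpairsP/idP => [[[j c] /= [+ _ [-> _]]]|ilt]; first by rewrite mem_iota.
by exists (i, b); split=> //; [rewrite mem_iota | case: b].
Qed.

Lemma mem_code_out v w : (w \in code_out v) <-> step v.1 w.1 (w.2 - v.2).
Proof.
rewrite mem_undup; case: v w => [x q] [y r] /=; split.
- rewrite /steps /=; case: x => [u|xs|xs i b|] //.
  + case: asboolP => // vx /allpairsPdep[[i b] [d [+ dd [-> ->]]]] /=.
    rewrite positionsP => ilt; rewrite (Z.add_comm q) Z.add_simpl_r.
    exact: StepCenter.
  + move=> /mapP[d dd [-> ->]]; rewrite (Z.add_comm q) Z.add_simpl_r.
    exact: StepNode.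
  + rewrite inE => /eqP[-> ->]; rewrite (_ : (q + 1 - q = 1)%Z); last lia.
    exact: StepMarker.
- move: (r - q)%Z (Zplus_minus q r) => D <-.
  case=> [xs i b d vx ilt dd|xs i b d dd|]; rewrite /steps /=.
  + case: asboolP => // _; apply/allpairsPdep; exists (i, b), d.
    by rewrite positionsP.
  + by apply/mapP; exists d.
  + by rewrite inE.
Qed.

Definition code_color (v : site vertex) : bool :=
  match v.1 with Node _ _ _ => true | Marker => Z.odd v.2 | _ => false end.

Lemma code_out_uniq v : uniq (code_out v).
Proof. exact: undup_uniq. Qed.

Lemma code_out_raise k v :
  perm_eq (code_out (raise k v)) [seq raise k w | w <- code_out v].
Proof.
apply: uniq_perm; rewrite ?code_out_uniq //.
  by rewrite map_inj_uniq ?code_out_uniq //; apply: raise_inj.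
move=> w; rewrite -[w](raiseVK k) mem_map; last exact: raise_inj.
have E (b b' : bool) : (b <-> b') -> b = b' by move=> h; apply/idP/idP => /h.
apply: E; rewrite !mem_code_out /=.
by rewrite (_ : (w.2 + - k + k - (v.2 + k) = w.2 + - k - v.2)%Z) //; lia.
Qed.

Lemma code_out_color v w : w \in code_out v -> code_color w = ~~ code_color v.
Proof.
move=> /mem_code_out; case: v w => [x q] [y r] /=.
move: (r - q)%Z (Zplus_minus q r) => D <-; rewrite /code_color.
by case=> [xs i b d vx ilt dd|xs i b d dd|] //=; rewrite Z.odd_add; case: (Z.odd q).
Qed.

Definition code_graph : site_graph vertex :=
  SiteGraph code_out_uniq code_out_raise code_out_color.

Let adjacent := adj code_graph.

Lemma step_asym x y d : step x y d -> step y x (- d) -> False.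
Proof. by case=> [xs i b d' _ _ _|xs i b d' _|] h; inversion h. Qed.

Lemma adjacentP v w : adjacent v w <->
  step v.1 w.1 (w.2 - v.2) \/ step w.1 v.1 (v.2 - w.2).
Proof.
rewrite /adjacent /adj /arrow; split.
  case: (boolP (w \in _)) => [/mem_code_out|_]; first by left.
  by rewrite addFb => /mem_code_out; right.
case=> h.
  rewrite ((mem_code_out _ _).2 h); apply/negP => /mem_code_out h'.
  apply: step_asym h _; rewrite (_ : (- (w.2 - v.2) = v.2 - w.2)%Z) //; lia.
rewrite addbC ((mem_code_out _ _).2 h); apply/negP => /mem_code_out h'.
apply: step_asym h _; rewrite (_ : (- (v.2 - w.2) = w.2 - v.2)%Z) //; lia.
Qed.

Inductive link : vertex -> vertex -> nat -> Prop :=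
| LinkCenter xs i b : valid xs -> i < size xs ->
    link (Center xs) (Node xs i b) (offset (size xs) i b)
| LinkEntry xs i b :
    link (Node xs i b) (Entry (factor (nth (1, 1) xs i) b)) 3.

Lemma levels_two n d d' : d \in levels n -> d' \in levels n -> d <> d' ->
  (Z.of_nat d' - Z.of_nat d = Z.of_nat n \/ Z.of_nat d - Z.of_nat d' = Z.of_nat n)%Z.
Proof.
by rewrite !levelsP => /orP[]/eqP-> /orP[]/eqP-> // _; [left | right]; lia.
Qed.

Lemma step_two x y D D' : step x y D -> step x y D' -> D <> D' ->
  exists2 n : nat, link x y n & (D' - D = Z.of_nat n \/ D - D' = Z.of_nat n)%Z.
Proof.
case=> [xs i b d vx ilt dd|xs i b d dd|] h ne.
- exists (offset (size xs) i b); first exact: LinkCenter.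
  inversion h as [? ? ? d' _ _ dd'| |]; subst.
  by apply: levels_two => // E; apply: ne; rewrite E.
- exists 3; first exact: LinkEntry.
  inversion h as [|? ? ? d' dd'|]; subst.
  by apply: levels_two => // E; apply: ne; rewrite E.
- by inversion h; subst.
Qed.

Lemma step_back x y D D' : step x y D -> step y x D' -> x = Marker /\ y = Marker.
Proof. by case=> [xs i b d _ _ _|xs i b d _|] h; inversion h. Qed.

Lemma step_marker D x : step x x D -> x = Marker /\ D = 1%Z.
Proof. by move=> h; inversion h. Qed.

(** Two adjacencies between the same two vertices reveal the link, up to its
direction.  Distance 2 is excluded as it occurs for the marker. *)
Lemma adjacent_two v w k (n : nat) : k = 1%Z \/ k = (-1)%Z -> 2 < n ->
  adjacent v w -> adjacent v (raise (k * Z.of_nat n) w) ->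
  link v.1 w.1 n \/ link w.1 v.1 n.
Proof.
move=> k1 /ltP n2 /adjacentP + /adjacentP; case: v w => [x q] [y r] /=.
set D := (k * _)%Z => h h'.
have {k1} Dn : (D = Z.of_nat n \/ D = - Z.of_nat n)%Z by rewrite /D; lia.
clearbody D.
have D0 : (r - q <> r + D - q)%Z by lia.
have D1 : (q - r <> q - (r + D))%Z by lia.
case: h h' => [h|h] [h'|h'].
- have [m xy mE] := step_two h h' D0; left.
  by rewrite (_ : n = m) //; lia.
- have [xE yE] := step_back h h'; subst.
  have [_ E] := step_marker h; have [_ E'] := step_marker h'; lia.
- have [xE yE] := step_back h h'; subst.
  have [_ E] := step_marker h; have [_ E'] := step_marker h'; lia.
- have [m xy mE] := step_two h h' D1; right.
  by rewrite (_ : n = m) //; lia.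
Qed.

Lemma adjacent_marker x q k : adjacent (x, q) (raise k (x, q)) ->
  x = Marker /\ (k = 1%Z \/ k = (-1)%Z).
Proof. by move=> /adjacentP[] /step_marker /= [-> E]; split=> //; lia. Qed.

Let G := site_group code_graph.
Let e : G := site_neg code_graph.
Let v0 : site vertex := (Marker, 0%Z).

Lemma offset_inj n i b n' i' b' : offset n i b = offset n' i' b' ->
  [/\ n = n', i = i' & b = b'].
Proof. by move=> [] /(pcan_inj (@choice.pickleK _)) [-> -> ->]. Qed.

Lemma link_offset x y m j c : link x y (offset m j c) ->
  exists ys, [/\ valid ys, size ys = m, j < m, x = Center ys & y = Node ys j c].
Proof.
move: {-1}(offset m j c) (erefl (offset m j c)) => n nE h.
case: h nE => [ys i b vys ilt|ys i b] // /offset_inj[mE jE cE]; subst.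
by exists ys.
Qed.

Lemma link_3 x y : link x y 3 ->
  exists ys i b, x = Node ys i b /\ y = Entry (factor (nth (1, 1) ys i) b).
Proof.
move: {-1}3 (erefl 3) => n nE h.
by case: h nE => [ys i b vys ilt|ys i b] // _; exists ys, i, b.
Qed.

(** The default value matters only for elements that are not at an entry. *)
Definition entry_of (g : G) : U :=
  xget 1 [set u | exists q, at_site g (Entry u, q)].

Lemma entry_ofE g u q : at_site g (Entry u, q) -> entry_of g = u.
Proof.
move=> gu; rewrite /entry_of; case: xgetP => [_ -> [r gv]|/(_ u)[]]; last by exists q.
by have [->] := at_site_uniq gu gv.
Qed.

Let sites_of := @linked_sites _ code_graph v0.

Lemma conj_invol (g t : G) : g * g = 1 -> g ^ t * g ^ t = 1.
Proof. by rewrite -conjMg => ->; rewrite conj1g. Qed.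

Lemma linked_two (g h t : G) l k n : rep t l k -> k = 1%Z \/ k = (-1)%Z -> 2 < n ->
  g * g = 1 -> h * h = 1 -> linked e g h -> linked e g (h ^ (t ^+ n)) ->
  exists v w, [/\ at_site g v, at_site h w & link v.1 w.1 n \/ link w.1 v.1 n].
Proof.
move=> tl k1 n2 g2 h2 gh ght.
have [v [w [gv hw vw]]] := sites_of g2 h2 gh.
have [v' [w' [gv' hw' vw']]] := sites_of g2 (conj_invol _ h2) ght.
have [l' tn] := repX n tl; have hw'' := at_site_conj hw tn.
exists v, w; split=> //; apply: (@adjacent_two _ _ (- k)) vw _ => //; first by lia.
rewrite -(at_site_uniq gv' gv) (_ : raise _ w = w') //.
rewrite (at_site_uniq hw' hw''); congr raise; lia.
Qed.

(** The marker shows that t translates by 1 or by -1.  Two links of different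
types start from z, hence z is not a node and the links are not reversed: the
nodes and then the factors of the sequence at z are recovered one by one. *)
Lemma decode (xs : seq (G * G)) :
  coded e xs -> valid [seq (entry_of p.1, entry_of p.2) | p <- xs].
Proof.
case=> sz [t [y [z [p [[y2 yt] z2 p2 x2 zp px]]]]].
have [b0 [l [k tE]]] := site_eltE t; have tl : rep t l k by exists b0.
have k1 : k = 1%Z \/ k = (-1)%Z.
  have [v [w [yv yw vw]]] := sites_of y2 (conj_invol t y2) yt.
  move: vw; rewrite (at_site_uniq yw (at_site_conj yv tl)); case: (v) => x q.
  by move=> /adjacent_marker[_]; lia.
have node i b : i < size xs -> exists v w,
    [/\ at_site z v, at_site (p i b) w & link v.1 w.1 (offset (size xs) i b) \/
       link w.1 v.1 (offset (size xs) i b)].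
  move=> ilt; have [zp1 zp2] := zp i b ilt.
  exact: (linked_two tl k1 _ z2 (p2 i b ilt) zp1 zp2).
have [ys [q [vys sys zE]]] : exists ys q,
    [/\ valid ys, size ys = size xs & at_site z (Center ys, q)].
  have [[c q] [[x r] [zv _ /= vw]]] := node 0 false (ltnW sz).
  have [v' [w' [zv' _]]] := node 0 true (ltnW sz).
  rewrite (at_site_uniq zv' zv) /= => vw'.
  case: vw => /link_offset[ys [vys sys _ cE xE]]; subst c; first by exists ys, q.
  by case: vw' => /link_offset[? [_ _ _ h h']]; [discriminate h | discriminate h'].
have nodeE i b : i < size xs -> exists r, at_site (p i b) (Node ys i b, r).
  move=> ilt; have [v [[x r] [zv pw]]] := node i b ilt.
  rewrite (at_site_uniq zv zE) /= => -[] /link_offset[zs [_ _ _ //]].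
  by move=> [<-] xE; exists r; rewrite -xE.
have entryE i b : i < size xs ->
    entry_of (factor (nth (1, 1) xs i) b) = factor (nth (1, 1) ys i) b.
  move=> ilt; have [px1 px2] := px i b ilt.
  have [v [[x r] [pv xw vw]]] :=
    linked_two tl k1 (erefl : 2 < 3) (p2 i b ilt) (x2 i b ilt) px1 px2.
  have [r' pr'] := nodeE i b ilt.
  move: vw; rewrite (at_site_uniq pv pr') /= => -[] /link_3[zs [j [c []]]] //.
  by move=> [<- <- <-] xE; apply: (@entry_ofE _ _ r); rewrite -xE.
suff -> : [seq (entry_of p.1, entry_of p.2) | p <- xs] = ys by [].
apply: (@eq_from_nth _ (1, 1)); rewrite size_map // => i ilt.
rewrite (nth_map (1, 1)) // [RHS]surjective_pairing; congr pair.
  exact: entryE false ilt.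
exact: entryE true ilt.
Qed.

Definition entry_gen (u : U) : G := site_flip code_graph (Entry u, 0%Z).

Lemma entry_of_gen u : entry_of (entry_gen u) = u.
Proof. exact/entry_ofE/at_site_flip. Qed.

Lemma encode (xs : seq (U * U)) : 1 < size xs -> valid xs ->
  coded e [seq (entry_gen p.1, entry_gen p.2) | p <- xs].
Proof.
move=> sz vxs; split; first by rewrite size_map.
pose gen x : G := site_flip code_graph (x, 0%Z).
exists (site_shift code_graph (-1)), (gen Marker), (gen (Center xs)),
  (fun i b => gen (Node xs i b)).
have gen2 x : gen x * gen x = 1 by apply: site_flip2.
have entryE i b : i < size xs ->
    factor (nth (1, 1) [seq (entry_gen p.1, entry_gen p.2) | p <- xs] i) b =
    gen (Entry (factor (nth (1, 1) xs i) b)).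
  by move=> ilt; rewrite (nth_map (1, 1)) //; case: b.
have linkedE x y n : step x y (Z.of_nat n) ->
    linked e (gen x) (gen y ^ (site_shift code_graph (-1) ^+ n)).
  move=> xy; rewrite site_flip_conj; apply: site_flip_linked; apply/adjacentP.
  by left; rewrite /= Z.sub_0_r.
have linkedE0 x y : step x y 0 -> linked e (gen x) (gen y).
  by move=> /(linkedE _ _ 0); rewrite expg0 conjg1.
split; rewrite ?size_map //.
- by split=> //; rewrite -[site_shift _ _]expg1; apply: linkedE; apply: StepMarker.
- by move=> i b ilt; rewrite entryE.
- move=> i b ilt; split; [apply: linkedE0 | apply: linkedE].
    by apply: (@StepCenter _ _ _ 0) => //; rewrite levelsP eqxx.
  by apply: StepCenter => //; rewrite levelsP eqxx orbT.
- move=> i b ilt; rewrite entryE //; split; [apply: linkedE0 | apply: linkedE].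
    by apply: (@StepNode _ _ _ 0) => //; rewrite levelsP eqxx.
  by apply: StepNode => //; rewrite levelsP eqxx orbT.
Qed.

End CodeGraph.

(** * Every coherent fuzzy ring is a retract *)

Section SectionMap.
Variables (Y P : fuzzy_ring) (gamma : units Y -> units P).
Hypothesis gamma_null : forall xs : seq (units Y * units Y), 1 < size xs ->
  unull [seq p.1 * p.2 | p <- xs] -> unull [seq gamma p.1 * gamma p.2 | p <- xs].

Let e : units Y := ueps Y.
Let nullY := fuzzy_null Y.
Let nullP := fuzzy_null P.

(** The hypothesis means that a b + c d is null. *)
Lemma gamma_neg a b c d : c * d = e * (a * b) ->
  gamma c * gamma d = ueps P * (gamma a * gamma b).
Proof.
move=> cd; apply/(null_pairP nullP).
by have /= := gamma_null (xs := [:: (a, b); (c, d)]) erefl; apply; apply/(null_pairP nullY).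
Qed.

(** Compare both products with eps (a b), written as (eps a) b. *)
Lemma gamma_prod a b c d : a * b = c * d -> gamma a * gamma b = gamma c * gamma d.
Proof.
move=> ab; have h1 : e * a * b = e * (c * d) by rewrite -mulgA ab.
have h2 : e * a * b = e * (a * b) by rewrite mulgA.
by move: (gamma_neg h1); rewrite (gamma_neg h2) => /mulgI.
Qed.

Lemma gamma1C a : gamma a * gamma 1 = gamma 1 * gamma a.
Proof. by apply: gamma_prod; rewrite mulg1 mul1g. Qed.

(** By [gamma_prod], gamma a * gamma b = gamma (a * b) * gamma 1. *)
Definition section_fun (a : units Y) : units P := gamma a * (gamma 1)^-1.

Fact section_funM : {morph section_fun : a b / a * b}.
Proof.
move=> a b; rewrite /section_fun.
have -> : gamma a * (gamma 1)^-1 * (gamma b * (gamma 1)^-1) =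
    gamma a * gamma b * (gamma 1)^-1 * (gamma 1)^-1.
  have comm : commute (gamma b) (gamma 1)^-1 by apply/commuteV/gamma1C.
  by rewrite !mulgA -(mulgA (gamma a)) -comm !mulgA.
by rewrite (@gamma_prod a b (a * b) 1) ?mulg1 // mulgK.
Qed.

Fact section_fun_null s : unull s -> unull [seq section_fun a | a <- s].
Proof.
case: s => [|a [|b s]] Ns; first exact: null_nil nullP.
  case: (null_unit nullY); have := null_mulr nullY a^-1 Ns.
  by rewrite /= mulgV.
have := gamma_null (xs := [seq (c, 1) | c <- [:: a, b & s]]).
rewrite -!map_comp size_map => /(_ erefl).
rewrite (eq_map (g := id)) ?map_id => [/(_ Ns)|c]; last by rewrite /= mulg1.
move=> /(null_mulr nullP ((gamma 1)^-1 * (gamma 1)^-1)); rewrite -map_comp.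
by congr unull; apply: eq_map => c; rewrite /= mulgA mulgK.
Qed.

Definition section_hom : fuzzy_hom Y P := weak_of section_funM section_fun_null.

End SectionMap.

Section Dominance.
Variable Y : coherent_fuzzy_ring.

Definition null_products (xs : seq (units Y * units Y)) : Prop :=
  unull [seq p.1 * p.2 | p <- xs].

Let gr := code_graph null_products.
Let e := site_neg gr.

Definition code_group : signed_group :=
  SignedGroup (site_negC (gr := gr)) (site_neg2 gr) (@site_neg_neq1 _ gr).

Definition code_system : hyper_system := coarse_hyper_system code_group.

Let X := code_system.
Let unit_of (g : site_group gr) : units X := coarse_units (H := code_group) g.

Lemma unit_of_surj (u : units X) : exists g, u = unit_of g.
Proof. exact: (@coarse_units_surj code_group u). Qed.

Let elt_of (u : units X) : site_group gr := sval (cid (unit_of_surj u)).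

Let elt_ofK u : unit_of (elt_of u) = u.
Proof. by rewrite /elt_of; case: cid. Qed.

Let unit_ofK g : elt_of (unit_of g) = g.
Proof. by apply: (@coarse_units_inj code_group); apply: elt_ofK. Qed.

Let unit_ofM : {morph unit_of : g h / g * h}.
Proof. by move=> g h; apply/val_inj. Qed.

Let elt_ofM : {morph elt_of : u v / u * v}.
Proof.
by move=> u v; rewrite -[RHS]unit_ofK unit_ofM !elt_ofK.
Qed.

Let neg1E : neg1 X = unit_of e.
Proof. by apply/val_inj; rewrite /= mulg1. Qed.

Definition retraction_fun (u : units X) : units Y := entry_of (elt_of u).

Fact retraction_rel (xs : seq (units X * units X)) : coded (neg1 X) xs ->
  unull [seq retraction_fun p.1 * retraction_fun p.2 | p <- xs].
Proof.
move=> /(coded_morph elt_ofM); rewrite neg1E unit_ofK => /decode.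
by rewrite /null_products -!map_comp.
Qed.

Definition retraction : fuzzy_hom (coding_ring X) Y :=
  pres_lift (phi := retraction_fun) (@coded_size _ (neg1 X)) retraction_rel.

Let gamma (a : units Y) : units (coding_ring X) :=
  pres_gen (@coded_size _ (neg1 X)) (unit_of (entry_gen null_products a)).

Fact gamma_rel (xs : seq (units Y * units Y)) : 1 < size xs ->
  unull [seq p.1 * p.2 | p <- xs] -> unull [seq gamma p.1 * gamma p.2 | p <- xs].
Proof.
move=> sz /(encode sz) /(coded_morph unit_ofM); rewrite -neg1E.
by move=> /(pres_gen_rel (@coded_size _ (neg1 X))); rewrite -!map_comp.
Qed.

Lemma retract_coding : @retract wFR Y (coding_ring X).
Proof.
exists (section_hom gamma_rel), retraction.
apply: weak_hom_eq => a.
have gammaK b : retraction (gamma b) = b.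
  by rewrite /retraction pres_lift_gen /retraction_fun unit_ofK entry_of_gen.
transitivity (retraction (section_fun gamma a)); first by [].
rewrite /section_fun weak_homM (morphV (weak_homM retraction)) !gammaK.
by rewrite invg1 mulg1.
Qed.
End Dominance.

Theorem theorem6p5 : exists Psi : functor hyper_systems wFR, dominant Psi.
Proof. by exists coding_functor => Y; exists (code_system Y); apply: retract_coding. Qed.
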